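(* The query language $(\mathrm{UNFO},\mathrm{UCQ})$ has the same expressive power as MDDlog (over schemas with relation symbols of arbitrary arity).
   Context: **Queries.** A schema $\mathbf{S}$ is a finite set of relation symbols with arities. An instance $\mathfrak{D}$ over $\mathbf{S}$ is a finite set of facts $R(a_1,\dots,a_n)$, $R\in\mathbf{S}$, with $a_i$ from a fixed countably infinite set of constants; $\mathrm{adom}(\mathfrak{D})$ is the set of constants occurring in $\mathfrak{D}$. An $n$-ary query over $\mathbf{S}$ maps each $\mathbf{S}$-instance $\mathfrak{D}$ to a set $q(\mathfrak{D})\subseteq \mathrm{adom}(\mathfrak{D})^n$. Two queries over $\mathbf{S}$ are equivalent if they agree on all $\mathbf{S}$-instances. A query language is a set of queries. $\mathcal{Q}_2$ is at least as expressive as $\mathcal{Q}_1$ if every query of $\mathcal{Q}_1$ over some schema $\mathbf{S}$ is equivalent to a query of $\mathcal{Q}_2$ over $\mathbf{S}$; they have the same expressive power if this holds in both directions. UCQ is the class of unions of conjunctive queries (without constants; equality allowed). **Ontology-mediated queries.** An ontology language $\mathcal{L}$ is a set of first-order (FO) sentences; an $\mathcal{L}$-ontology $\mathcal{O}$ is a finite set of sentences of $\mathcal{L}$, and $\mathrm{sig}(\mathcal{O})$ is the set of its relation symbols. An ontology-mediated query is a triple $(\mathbf{S},\mathcal{O},q)$ with $\mathbf{S}$ a schema (the data schema), $\mathcal{O}$ an ontology and $q$ a query over $\mathbf{S}\cup\mathrm{sig}(\mathcal{O})$. A finite relational structure over a schema is a pair $(\mathrm{dom},\mathfrak{D})$ with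 $\mathrm{dom}$ a finite non-empty set and $\mathfrak{D}$ an instance over the schema with $\mathrm{adom}(\mathfrak{D})\subseteq\mathrm{dom}$. The triple defines the query over $\mathbf{S}$ that maps $\mathfrak{D}$ to the set of certain answers: all $\mathbf{a}\in\mathrm{adom}(\mathfrak{D})^n$ such that $\mathbf{a}\in q(\mathfrak{D}')$ for every finite relational structure $(\mathrm{dom},\mathfrak{D}')$ over $\mathbf{S}\cup\mathrm{sig}(\mathcal{O})$ that satisfies $\mathcal{O}$ and has $\mathfrak{D}\subseteq\mathfrak{D}'$. $(\mathcal{L},\mathcal{Q})$ denotes the query language of all queries defined by ontology-mediated queries $(\mathbf{S},\mathcal{O},q)$ with $\mathcal{O}$ an $\mathcal{L}$-ontology and $q\in\mathcal{Q}$. **UNFO.** The unary-negation fragment UNFO consists of the FO formulas generated from atomic formulas, including equality, using conjunction, disjunction, existential quantification, and unary negation, i.e. negation applied to a formula with at most one free variable. **MDDlog.** A disjunctive datalog rule has the form $S_1(\mathbf{x}_1)\vee\cdots\vee S_m(\mathbf{x}_m)\leftarrow R_1(\mathbf{y}_1)\wedge\cdots\wedge R_n(\mathbf{y}_n)$, $m\ge 0$, $n>0$, where every head variable occurs in the body (empty head: $\bot$). A disjunctive datalog (DDlog) program $\Pi$ is a finite set of such rules with a selected predicate $\mathsf{goal}$ that does not occur in rule bodies and occurs in heads only in rules $\mathsf{goal}(\mathbf{x})\leftarrow R_1(\mathbf{x}_1)\wedge\cdots\wedge R_n(\mathbf{x}_n)$. Relation symbols occurring in some rule head are IDB predicates,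 the others EDB predicates. $\Pi$ defines the query $q_\Pi$ over the schema of its EDB predicates: $q_\Pi(\mathfrak{D})$ is the set of $\mathbf{a}\in\mathrm{adom}(\mathfrak{D})^n$ ($n$ the arity of $\mathsf{goal}$) with $\mathsf{goal}(\mathbf{a})\in\mathfrak{D}'$ for all instances $\mathfrak{D}'\supseteq\mathfrak{D}$ over the IDB and EDB predicates satisfying all rules of $\Pi$. $\Pi$ is an MDDlog program if all IDB predicates except possibly $\mathsf{goal}$ are unary. MDDlog denotes the language of all queries defined by MDDlog programs.
   Formalization: Equivalence of queries is required only on nonempty instances: on the empty instance no MDDlog program returns the empty tuple, whereas the ontology-mediated query with ontology ∃x A(x) and query ∃x A(x) does, so the literal claim fails there. *)

(* Defs.v *)
From Stdlib Require List.
From mathcomp Require Import all_boot finmap.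

Set Implicit Arguments.
Unset Strict Implicit.
Unset Printing Implicit Defensive.

Local Open Scope fset_scope.

(* A symbol is a pair (name, arity): there are infinitely many symbols of each
   arity, and arity 0 is allowed. *)
Definition symbol : Type := (nat * nat)%type.
Definition arity (R : symbol) : nat := R.2.

Definition const : Type := nat.
Definition var : Type := nat.

Definition schema := {fset symbol}.

(* [atom const] is the type of facts, [atom var] that of relational atoms. *)
Definition atom (T : Type) : Type := {R : symbol & (arity R).-tuple T}.

Definition mk_atom T (R : symbol) (t : (arity R).-tuple T) : atom T :=
  existT (fun R => (arity R).-tuple T) R t.

Definition atom_sym T (a : atom T) : symbol := tag a.
Definition atom_args T (a : atom T) : seq T := tagged a.
Definition atom_map T U (f : T -> U) (a : atom T) : atom U :=
  mk_atom (map_tuple f (tagged a)).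

Definition instance := {fset atom const}.

Definition instance_over (S : schema) (D : instance) : Prop :=
  forall f, f \in D -> atom_sym f \in S.

Definition adom (D : instance) : {fset const} :=
  \bigcup_(f <- D) [fset c in atom_args f].

(* Only the values of [answers] on instances over [S] are meaningful. *)
Record query (S : schema) (n : nat) : Type := Query {
  answers :> instance -> n.-tuple const -> Prop;
  answers_adom : forall D a,
    instance_over S D -> answers D a -> {subset a <= adom D} }.

(* Agreement is required on all nonempty instances. The empty instance has to be
   left out: rule bodies are nonempty, so a datalog program never returns the
   empty tuple on it, whereas the Boolean query "exists x, A x" mediated by the
   ontology stating "exists x, A x" does, since structures have nonempty
   domains. *)
Definition equivalent S n (q1 q2 : query S n) : Prop :=
  forall D, instance_over S D -> D != fset0 -> forall a, q1 D a <-> q2 D a.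

Definition query_language : Type := forall S n, query S n -> Prop.

Definition at_least_as_expressive (Q2 Q1 : query_language) : Prop :=
  forall S n (q1 : query S n), Q1 S n q1 ->
    exists2 q2 : query S n, Q2 S n q2 & equivalent q1 q2.

Definition same_expressive_power (Q1 Q2 : query_language) : Prop :=
  at_least_as_expressive Q1 Q2 /\ at_least_as_expressive Q2 Q1.

Inductive formula : Type :=
| Rel of atom var
| Equal of var & var
| Not of formula
| And of formula & formula
| Or of formula & formula
| Ex of var & formula
| All of var & formula.

Fixpoint free_vars (phi : formula) : {fset var} :=
  match phi with
  | Rel a => [fset x in atom_args a]
  | Equal x y => [fset x; y]
  | Not p => free_vars p
  | And p q | Or p q => free_vars p `|` free_vars q
  | Ex x p | All x p => free_vars p `\ x
  end.

Fixpoint formula_sig (phi : formula) : schema :=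
  match phi with
  | Rel a => [fset atom_sym a]
  | Equal _ _ => fset0
  | Not p | Ex _ p | All _ p => formula_sig p
  | And p q | Or p q => formula_sig p `|` formula_sig q
  end.

Definition sentence (phi : formula) : Prop := free_vars phi = fset0.

Fixpoint sat (dom : {fset const}) (D : instance) (v : var -> const)
    (phi : formula) : Prop :=
  match phi with
  | Rel a => atom_map v a \in D
  | Equal x y => v x = v y
  | Not p => ~ sat dom D v p
  | And p q => sat dom D v p /\ sat dom D v q
  | Or p q => sat dom D v p \/ sat dom D v q
  | Ex x p => exists2 c, c \in dom & sat dom D [eta v with x |-> c] p
  | All x p => forall c, c \in dom -> sat dom D [eta v with x |-> c] p
  end.

Fixpoint unfo (phi : formula) : bool :=
  match phi with
  | Rel _ | Equal _ _ => true
  | Not p => unfo p && (#|` free_vars p| <= 1)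
  | And p q | Or p q => unfo p && unfo q
  | Ex _ p => unfo p
  | All _ _ => false
  end.

Fixpoint is_atom_conj (phi : formula) : bool :=
  match phi with
  | Rel _ | Equal _ _ => true
  | And p q => is_atom_conj p && is_atom_conj q
  | _ => false
  end.

Fixpoint is_cq (phi : formula) : bool :=
  if phi is Ex _ p then is_cq p else is_atom_conj phi.

Fixpoint is_ucq (phi : formula) : bool :=
  if phi is Or p q then is_ucq p && is_ucq q else is_cq phi.

(* Active domain semantics; [xs] are the answer variables. *)
Definition fo_answers n (xs : n.-tuple var) (phi : formula)
    (D : instance) (a : n.-tuple const) : Prop :=
  {subset a <= adom D} /\
  exists2 v, map_tuple v xs = a & sat (adom D) D v phi.

Lemma fo_answers_adom S n (xs : n.-tuple var) phi D a :
  instance_over S D -> fo_answers xs phi D a -> {subset a <= adom D}.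
Proof. by move=> _ []. Qed.

Definition fo_query S n (xs : n.-tuple var) phi : query S n :=
  Query (@fo_answers_adom S n xs phi).

Inductive UCQ : query_language :=
| UCQ_query S n (xs : n.-tuple var) phi of
    is_ucq phi & uniq xs & {subset free_vars phi <= xs} &
    formula_sig phi `<=` S : UCQ (fo_query S xs phi).

Definition ontology_language : Type := formula -> Prop.

Definition UNFO : ontology_language := fun phi => sentence phi /\ unfo phi.

Definition ontology (L : ontology_language) (O : seq formula) : Prop :=
  List.Forall L O.

Definition ontology_sig (O : seq formula) : schema :=
  \bigcup_(phi <- O) formula_sig phi.

Definition models (dom : {fset const}) (D : instance) (O : seq formula) : Prop :=
  List.Forall (fun phi => forall v, sat dom D v phi) O.

Definition is_structure (S : schema) (dom : {fset const}) (D : instance) : Prop :=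
  [/\ dom != fset0, instance_over S D & adom D `<=` dom].

Definition certain_answers S O n (q : query (S `|` ontology_sig O) n)
    (D : instance) (a : n.-tuple const) : Prop :=
  {subset a <= adom D} /\
  forall dom D', is_structure (S `|` ontology_sig O) dom D' ->
    models dom D' O -> D `<=` D' -> q D' a.

Lemma certain_answers_adom S O n (q : query (S `|` ontology_sig O) n) D a :
  instance_over S D -> certain_answers q D a -> {subset a <= adom D}.
Proof. by move=> _ []. Qed.

Definition omq_query S O n (q : query (S `|` ontology_sig O) n) : query S n :=
  Query (@certain_answers_adom S O n q).

Inductive OMQ (L : ontology_language) (Q : query_language) : query_language :=
| OMQ_query S O n (q : query (S `|` ontology_sig O) n) of
    ontology L O & Q _ _ q : OMQ L Q (omq_query q).

Record rule : Type :=
  Rule { rule_head : seq (atom var); rule_body : seq (atom var) }.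

Record program : Type := Program { rules : seq rule; goal : symbol }.

Definition atoms_vars (s : seq (atom var)) : {fset var} :=
  \bigcup_(a <- s) [fset x in atom_args a].

Definition atoms_syms (s : seq (atom var)) : schema :=
  [fset R in map (@atom_sym var) s].

Definition head_syms (P : program) : schema :=
  \bigcup_(r <- rules P) atoms_syms (rule_head r).

Definition body_syms (P : program) : schema :=
  \bigcup_(r <- rules P) atoms_syms (rule_body r).

Definition idb (P : program) : schema := head_syms P.
Definition edb (P : program) : schema := (head_syms P `|` body_syms P) `\` idb P.

Definition is_rule (r : rule) : Prop :=
  rule_body r <> [::] /\ atoms_vars (rule_head r) `<=` atoms_vars (rule_body r).

Definition is_ddlog (P : program) : Prop :=
  List.Forall (fun r =>
    [/\ is_rule r,
        goal P \notin atoms_syms (rule_body r) &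
        goal P \in atoms_syms (rule_head r) -> size (rule_head r) = 1]) (rules P).

Definition is_mddlog (P : program) : Prop :=
  is_ddlog P /\ forall R, R \in idb P -> R != goal P -> arity R = 1.

Definition sat_rule (D : instance) (r : rule) : Prop :=
  forall v : var -> const,
    all (fun a => atom_map v a \in D) (rule_body r) ->
    has (fun a => atom_map v a \in D) (rule_head r).

Definition ddlog_answers (P : program) (D : instance)
    (a : (arity (goal P)).-tuple const) : Prop :=
  {subset a <= adom D} /\
  forall D' : instance, D `<=` D' -> instance_over (idb P `|` edb P) D' ->
    List.Forall (sat_rule D') (rules P) -> mk_atom a \in D'.

Lemma ddlog_answers_adom P D a :
  instance_over (edb P) D -> ddlog_answers (P := P) D a -> {subset a <= adom D}.
Proof. by move=> _ []. Qed.

Definition ddlog_query (P : program) : query (edb P) (arity (goal P)) :=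
  Query (@ddlog_answers_adom P).

Inductive MDDlog : query_language :=
| MDDlog_query P of is_mddlog P : MDDlog (ddlog_query P).

(* Main.v *)
(* From MDDlog to (UNFO, UCQ): a rule without goal is a UNFO sentence, as its
   head atoms, which are to be negated, are unary; the goal rules together form
   a UCQ.

   From (UNFO, UCQ) to MDDlog: the type of depth i + 1 of an element c of a
   structure is the set of all patterns on boundedly many points (facts, and
   types of depth i of the points) realized with the first point at c. There
   are finitely many types of each depth, and they determine the UNFO formulas
   of bounded width and depth that hold at c. The program guesses a type for
   every data element and derives goal(a) from a bounded set of data elements
   containing a whenever no countermodel to the answer realizes their facts and
   types. If goal(a) is not derived, attach to each data element d a finite
   model B_d of the ontology in which the type guessed for d is realized. Every
   small part of the glued structure maps into one model, preserving types: move
   its pieces from the various B_d into a model realizing the data facts and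
   types of the elements d involved. Hence gluing does not change types, and the
   result is a countermodel. *)

From mathcomp Require Import all_boot finmap boolp.
Require Import Defs.

Set Implicit Arguments.
Unset Strict Implicit.
Unset Printing Implicit Defensive.

Local Open Scope fset_scope.

(** * Finite unions, atoms, active domains and valuations *)

Lemma in_bigfcup (I : Type) (T : choiceType) (s : seq I) (F : I -> {fset T}) x :
  (x \in \bigcup_(i <- s) F i) = has (fun i => x \in F i) s.
Proof. by elim: s => [|i s IH]; rewrite ?big_nil ?big_cons !inE // IH. Qed.

Lemma has_inP (I : Type) (a : pred I) s :
  reflect (exists2 i, List.In i s & a i) (has a s).
Proof.
elim: s => [|i s IH] /=; first by constructor; case.
apply: (iffP orP) => [[ai|/IH[j js aj]]|[j [<-|js] aj]].
- by exists i => //; left.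
- by exists j => //; right.
- by left.
- by right; apply/IH; exists j.
Qed.

Lemma In_map (U V : Type) (f : U -> V) s y :
  List.In y (map f s) <-> exists2 x, List.In x s & y = f x.
Proof.
elim: s => [|x s IH] /=; first by split=> [|[]].
rewrite IH; split=> [[<-|[z zs ->]]|[z [<-|zs] ->]].
- by exists x; auto.
- by exists z; auto.
- by left.
- by right; exists z.
Qed.

Lemma In_filter (U : Type) (p : pred U) s x :
  List.In x [seq y <- s | p y] <-> List.In x s /\ p x.
Proof.
elim: s => [|y s IH] /=; first by split=> [|[]].
case py : (p y) => /=; rewrite IH.
  by split=> [[<-|[xs px]]|[[->|xs] px]]; auto.
by split=> [[xs px]|[[yx|xs] px]]; auto; rewrite -yx py in px.
Qed.

Lemma adomP (D : instance) c :
  reflect (exists2 f, f \in D & c \in atom_args f) (c \in adom D).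
Proof.
rewrite /adom in_bigfcup; apply: (iffP hasP) => -[f fD];
  by rewrite ?inE => cf; exists f; rewrite ?inE.
Qed.

Lemma adomS (D E : instance) : D `<=` E -> {subset adom D <= adom E}.
Proof. by move=> /fsubsetP s c /adomP[f /s fE cf]; apply/adomP; exists f. Qed.

Lemma in_atoms_vars (s : seq (atom var)) x :
  (x \in atoms_vars s) = has (fun a => x \in atom_args a) s.
Proof. by rewrite /atoms_vars in_bigfcup; apply: eq_has => a; rewrite inE. Qed.

Lemma in_atoms_syms (s : seq (atom var)) R :
  (R \in atoms_syms s) = (R \in map (@atom_sym var) s).
Proof. by rewrite inE. Qed.

Lemma atom_map_sym T U (h : T -> U) a : atom_sym (atom_map h a) = atom_sym a.
Proof. by []. Qed.

Lemma atom_map_args T U (h : T -> U) a :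
  atom_args (atom_map h a) = map h (atom_args a).
Proof. by []. Qed.

Lemma eq_in_atom_map (T : eqType) U (h h' : T -> U) a :
  {in atom_args a, h =1 h'} -> atom_map h a = atom_map h' a.
Proof.
case: a => R t; rewrite /atom_args /atom_map /= => e.
by congr mk_atom; apply: val_inj; apply/eq_in_map.
Qed.

Lemma atom_map_comp T U V (h : T -> U) (h' : U -> V) a :
  atom_map h' (atom_map h a) = atom_map (h' \o h) a.
Proof.
by congr mk_atom; apply: val_inj; rewrite /= map_comp.
Qed.

Lemma atom_map_id_in (T : eqType) (h : T -> T) a :
  {in atom_args a, h =1 id} -> atom_map h a = a.
Proof.
move=> e; rewrite (eq_in_atom_map e); case: a {e} => R t.
by rewrite /atom_map /mk_atom /=; congr existT; apply: val_inj; rewrite /= map_id.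
Qed.

Lemma adom_map (D E : instance) (h : const -> const) c :
  (forall f, f \in D -> atom_map h f \in E) -> c \in adom D -> h c \in adom E.
Proof.
move=> DE /adomP[f fD cf]; apply/adomP; exists (atom_map h f); first exact: DE.
by rewrite atom_map_args map_f.
Qed.

(** Comprehension for facts: over a finite schema and finitely many constants there are only
    finitely many candidates, so an arbitrary property, decided classically, cuts out an
    instance. *)
Definition instance_of (S : schema) (C : {fset const})
    (P : atom const -> Prop) : instance :=
  [fset f in \bigcup_(R <- S)
    [fset f in [seq mk_atom (R := R) (map_tuple (@fsval _ C) t)
               | t <- enum {: (arity R).-tuple C}]] | `[< P f >]].

Lemma instance_ofP S C P f :
  f \in instance_of S C P <->
  [/\ atom_sym f \in S, {subset atom_args f <= C} & P f].
Proof.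
rewrite !inE in_bigfcup /=.
split=> [/andP[/hasP[R RS]] | [fS fC Pf]].
  rewrite !inE => /mapP[t _ ->] /asboolP Pf; split => // c /mapP[d _ ->].
  exact: valP.
rewrite (asboolT Pf) andbT; apply/hasP; exists (atom_sym f) => //.
case: f fS fC {Pf} => R t /= RS tC; rewrite inE.
apply/mapP; have tP i : tnth t i \in C by apply: tC; exact: mem_tnth.
exists [tuple FSetSub (tP i) | i < arity R]; first by rewrite mem_enum.
by rewrite /mk_atom; congr existT; apply: eq_from_tnth => i;
  rewrite tnth_map tnth_mktuple.
Qed.

Lemma mk_atom_inj T R : injective (@mk_atom T R).
Proof. by move=> t u /(congr1 (@atom_args T)) /val_inj. Qed.

Lemma sat_ext dom D v w phi :
  {in free_vars phi, v =1 w} -> sat dom D v phi <-> sat dom D w phi.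
Proof.
elim: phi v w => [a|x y|p IH|p IHp q IHq|p IHp q IHq|x p IH|x p IH] v w /= e.
- by rewrite (@eq_in_atom_map _ _ v w) // => x xa; apply: e; rewrite inE.
- by rewrite !e // !inE eqxx ?orbT.
- by have := IH v w e; tauto.
- have := IHp v w; have := IHq v w.
  by move=> -[x xq|? ?]; [|move=> -[x xp|? ?]; [|tauto]];
    apply: e; rewrite inE ?xp ?xq ?orbT.
- have := IHp v w; have := IHq v w.
  by move=> -[x xq|? ?]; [|move=> -[x xp|? ?]; [|tauto]];
    apply: e; rewrite inE ?xp ?xq ?orbT.
- split=> -[c cd sp]; exists c => //; move: sp; apply IH => y yp /=;
    by case: eqVneq => // yx; rewrite e // !inE yx.
- split=> sp c cd; move: (sp c cd); apply IH => y yp /=;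
    by case: eqVneq => // yx; rewrite e // !inE yx.
Qed.

Lemma sentence_sat dom D v w phi :
  sentence phi -> sat dom D v phi -> sat dom D w phi.
Proof. by move=> s; apply sat_ext => x; rewrite s inE. Qed.

Lemma card_fset_seq (T : choiceType) (s : seq T) : #|` [fset x in s]| <= size s.
Proof.
by apply: uniq_leq_size => [|x]; rewrite ?fset_uniq // inE.
Qed.

(** * Types *)

(** Facts whose arguments are abstract points; over a finite schema they form a finite type, which
    is what makes types finite objects. *)
Definition pfact (S : schema) (m : nat) : finType :=
  {R : S & (arity (fsval R)).-tuple 'I_m}.

Definition pfact_map S m T (h : 'I_m -> T) (f : pfact S m) : atom T :=
  mk_atom (R := fsval (tag f)) (map_tuple h (tagged f)).

Lemma pfact_map_comp S m T U (h : 'I_m -> T) (g : T -> U) (f : pfact S m) :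
  atom_map g (pfact_map h f) = pfact_map (g \o h) f.
Proof. by congr mk_atom; apply: val_inj; rewrite /= map_comp. Qed.

Lemma pull_fact S m (T : eqType) (r : T -> 'I_m) (f : atom T) :
  atom_sym f \in S ->
  exists pf : pfact S m, forall U (h : 'I_m -> U),
    pfact_map h pf = atom_map (h \o r) f.
Proof.
case: f => R t /= RS.
exists (existT (fun R : S => (arity (fsval R)).-tuple 'I_m)
  (FSetSub RS) (map_tuple r t)) => U h.
by congr mk_atom; apply: val_inj; rewrite /= map_comp.
Qed.

(** Depth 0 is a single bit, membership in the active domain: ontologies are evaluated over the
    whole domain but queries over the active domain, so maps between models must preserve this
    bit. *)
Fixpoint typ (S : schema) (k i : nat) : finType :=
  if i is j.+1 then {set {set pfact S k.+1} * {ffun 'I_k.+1 -> typ S k j}}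
  else bool.

(** Facts are only required to be present and points may coincide, so equal types yield
    homomorphisms of small parts in both directions, not isomorphisms. This matches a logic that
    negates unary formulas only. *)
Fixpoint tp S k i (dom : {fset const}) (D : instance) (c : const) :
    typ S k i :=
  if i is j.+1 then
    [set p : {set pfact S k.+1} * {ffun 'I_k.+1 -> typ S k j} | `[<
      exists h : 'I_k.+1 -> const,
      [/\ h ord0 = c, forall x, h x \in dom,
          forall f, f \in p.1 -> pfact_map h f \in D &
          forall x, p.2 x = tp S k j dom D (h x)] >]]
  else c \in adom D.

Definition local_hom S k i (W dA : {fset const}) (A : instance)
    (dB : {fset const}) (B : instance) (g : const -> const) : Prop :=
  [/\ forall c, c \in W -> g c \in dB,
      forall c, c \in W -> tp S k i dB B (g c) = tp S k i dA A c &
      forall f, f \in A -> {subset atom_args f <= W} -> atom_map g f \in B].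

Lemma local_homS S k i (W W' dA dB : {fset const}) A B g :
  {subset W <= W'} -> local_hom S k i W' dA A dB B g ->
  local_hom S k i W dA A dB B g.
Proof.
move=> sW [gd gt gf]; split=> [c /sW/gd|c /sW/gt|f fA fW] //.
by apply: gf => // c /fW/sW.
Qed.

(** The set [W], listed with [a] first and with all its facts and types, is itself a pattern in the
    type of [a]. It therefore lies in the type of [b], and its realization there is the map [g]. *)
Lemma tp_extend S k i (W dA dB : {fset const}) A B a b :
  instance_over S A ->
  tp S k i.+1 dA A a = tp S k i.+1 dB B b ->
  a \in W -> {subset W <= dA} -> #|` W| <= k.+1 ->
  exists2 g, g a = b & local_hom S k i W dA A dB B g.
Proof.
move=> SA eqt aW WdA cW.
(* The element [a] has to sit at index 0, the distinguished point of a pattern. *)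
pose s := a :: rem a (enum_fset W).
have sW : perm_eq s (enum_fset W) by rewrite perm_sym perm_to_rem.
have memW c : (c \in s) = (c \in W) by rewrite (perm_mem sW).
have ss : size s <= k.+1 by rewrite (perm_size sW).
pose h (j : 'I_k.+1) := nth a s j.
pose r c : 'I_k.+1 := inord (index c s).
have rK c : c \in W -> h (r c) = c.
  rewrite -memW => cs; rewrite /h inordK ?nth_index //.
  by apply: leq_trans ss; rewrite index_mem.
(* Indices beyond the list fall back to the default [a], which is in [W]. *)
have hW j : h j \in W.
  rewrite -memW /h; have [js|?] := ltnP j (size s); first exact: mem_nth.
  by rewrite nth_default ?mem_head.
pose p := ([set f | pfact_map h f \in A] : {set pfact S k.+1},
   [ffun x => tp S k i dA A (h x)]).
have : p \in tp S k i.+1 dA A a.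
  rewrite inE; apply/asboolP; exists h; split=> [//|x|f|x].
  - exact/WdA/hW.
  - by rewrite inE.
  - by rewrite ffunE.
rewrite eqt inE => /asboolP[h' [h'0 h'd h'f h't]].
exists (h' \o r).
  rewrite /= -h'0; congr h'; apply: ord_inj; rewrite inordK /= ?eqxx //.
split=> [c cW'|c cW'|f fA fW] /=; first exact: h'd.
  have <- : p.2 (r c) = tp S k i dB B (h' (r c)) := h't (r c).
  by rewrite ffunE rK.
have [pf pfE] := pull_fact r (SA f fA).
rewrite -(pfE _ h'); apply: h'f; rewrite inE pfE atom_map_id_in // => c /fW.
exact: rK.
Qed.

Lemma tp_pred S k i dA A a dB B b :
  instance_over S A -> a \in dA ->
  tp S k i.+1 dA A a = tp S k i.+1 dB B b -> tp S k i dA A a = tp S k i dB B b.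
Proof.
move=> SA adA e.
have [|c||] := @tp_extend S k i [fset a] _ _ _ _ _ _ SA e; rewrite ?inE //.
- by move=> /eqP->.
- by rewrite cardfs1.
by move=> g <- [_ gt _]; rewrite gt ?inE.
Qed.

Lemma tp_le S k i j dA A a dB B b :
  i <= j -> instance_over S A -> a \in dA ->
  tp S k j dA A a = tp S k j dB B b -> tp S k i dA A a = tp S k i dB B b.
Proof.
move=> ij SA adA; elim: j ij => [|j IH]; first by rewrite leqn0 => /eqP->.
rewrite leq_eqVlt => /orP[/eqP->//|ij e].
exact/IH/(tp_pred SA adA).
Qed.

Lemma tp_adom S k j dA A a dB B b :
  instance_over S A -> a \in dA ->
  tp S k j dA A a = tp S k j dB B b -> (a \in adom A) = (b \in adom B).
Proof. exact: (@tp_le S k 0). Qed.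

(** A fact without arguments is fixed by every map, so any map from [tp_extend] carries it over. *)
Lemma tp_nullary S k i dA A a dB B b f :
  instance_over S A -> a \in dA ->
  tp S k i.+1 dA A a = tp S k i.+1 dB B b ->
  atom_args f = [::] -> f \in A -> f \in B.
Proof.
move=> SA adA e fnil fA.
have [|c||] := @tp_extend S k i [fset a] _ _ _ _ _ _ SA e; rewrite ?inE //.
- by move=> /eqP->.
- by rewrite cardfs1.
move=> g _ [_ _ gf]; rewrite -(@atom_map_id_in _ g f) ?fnil //.
by apply: gf; rewrite ?fnil.
Qed.

(** Bounds the size of a witness set. Negation and quantification add one: the first for the element
    at which types are compared, the second for the quantified element. *)
Fixpoint width (phi : formula) : nat :=
  match phi with
  | Rel a => size (atom_args a)
  | Equal _ _ => 2
  | Not p | Ex _ p | All _ p => (width p).+1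
  | And p q | Or p q => width p + width q
  end.

(** Only nested negations are counted: a positive formula is transported by a single map, and each
    negation costs one level of types. *)
Fixpoint depth (phi : formula) : nat :=
  match phi with
  | Rel _ | Equal _ _ => 0
  | Not p => (depth p).+1
  | And p q | Or p q => maxn (depth p) (depth q)
  | Ex _ p | All _ p => depth p
  end.

Lemma unary_free_vars phi : #|` free_vars phi| <= 1 ->
  exists x, {subset free_vars phi <= [fset x]}.
Proof.
have [->|[x xf]] := fset_0Vmem (free_vars phi); first by exists 0.
move=> c1; exists x => y yf; rewrite inE.
case: eqP => // /eqP yx; suff: 2 <= #|` free_vars phi| by rewrite leqNgt ltnS c1.
have <- : #|` [fset x; y]| = 2 by rewrite cardfs2 eq_sym yx.
by apply: fsubset_leq_card; apply/fsubsetP => z; rewrite !inE => /orP[]/eqP->.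
Qed.

(* A UNFO formula is positive in its atoms and negated unary subformulas, so its
   truth is witnessed on a small set and transported by maps that preserve facts
   and types there. *)
Lemma sat_witness S k phi i dA A v :
  unfo phi -> depth phi <= i -> width phi <= k.+1 ->
  instance_over S A -> dA != fset0 ->
  (forall x, x \in free_vars phi -> v x \in dA) -> sat dA A v phi ->
  exists W : {fset const}, [/\ {subset W <= dA}, #|` W| <= width phi &
    forall dB B g, instance_over S B -> dB != fset0 ->
      local_hom S k i W dA A dB B g -> sat dB B (g \o v) phi].
Proof.
elim: phi i dA A v => [a|x y|p IH|p IHp q IHq|p IHp q IHq|x p IH|//] i dA A v
  /= up di wk SA dA0 vd sp.
- exists [fset c in map v (atom_args a)]; split.
  + by move=> c; rewrite inE => /mapP[x /= xa ->]; apply: vd; rewrite inE.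
  + by have := card_fset_seq (map v (atom_args a)); rewrite size_map.
  move=> dB B g SB dB0 [_ _ gf]; rewrite -atom_map_comp.
  by apply: gf => // c; rewrite inE.
- exists [fset v x; v y]; split.
  + by move=> c; rewrite !inE => /orP[]/eqP->; apply: vd; rewrite !inE eqxx ?orbT.
  + by rewrite cardfs2; case: eqP.
  by move=> dB B g SB dB0 _; rewrite sp.
- case/andP: up => up /unary_free_vars[x fx].
  have [c0 c0A] : exists c, c \in dA by apply/fset0Pn.
  (* If [p] has no free variable, an arbitrary element of the nonempty domain stands in for its
     value. *)
  pose c := if x \in free_vars p then v x else c0.
  have cA : c \in dA by rewrite /c; case: ifP => // /vd.
  have vc y : y \in free_vars p -> v y = c.
    by move=> yp; have := fx y yp; rewrite inE => /eqP yx; rewrite /c -yx yp.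
  exists [fset c]; split; rewrite ?cardfs1 //.
  + by move=> d; rewrite inE => /eqP->.
  case: i di => // i di dB B g SB dB0 [gd gt gf] spB.
  have gcB : g c \in dB by apply: gd; rewrite inE.
  (* If [p] held at [g c], a small witness set in [B] would show it. As [c] and [g c] have the same
     type of depth [i.+1], that set moves back to [A] with [g c] going to [c], so [p] would hold at
     [c]. *)
  case: (IH i dB B (fun=> g c)) => //.
  + exact: ltnW.
  + by move: spB; apply sat_ext => y /vc /= ->.
  move=> W [WB cW Wg].
  have gtc := gt c (fset11 c).
  case: (@tp_extend S k i (g c |` W) _ _ _ _ _ _ SB gtc); rewrite ?fset1U1 //.
  + by move=> d; rewrite !inE => /orP[/eqP->|/WB].
  + rewrite cardfsU1; apply: leq_trans wk; rewrite -add1n.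
    by apply: leq_add => //; exact: leq_b1.
  move=> g' g'c /(local_homS (fsubsetP (fsubsetUr _ _))) lh.
  apply: sp; have := Wg _ _ _ SA dA0 lh; apply sat_ext => y /vc ->.
  by rewrite /= g'c.
- case/andP: up => up uq; case: sp => sp sq.
  move: di; rewrite geq_max => /andP[dp dq].
  case: (IHp i dA A v) => //.
  + exact: leq_trans (leq_addr _ _) wk.
  + by move=> x xp; apply: vd; rewrite inE xp.
  move=> W [WA cW Wg].
  case: (IHq i dA A v) => //.
  + exact: leq_trans (leq_addl _ _) wk.
  + by move=> x xp; apply: vd; rewrite inE xp orbT.
  move=> X [XA cX Xg]; exists (W `|` X); split.
  + by move=> c; rewrite inE => /orP[/WA|/XA].
  + by rewrite (leq_trans (leq_card_fsetU _ _).1) // leq_add.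
  move=> dB B g SB dB0 lh; split.
  + by apply: Wg => //; apply: local_homS lh; exact/fsubsetP/fsubsetUl.
  + by apply: Xg => //; apply: local_homS lh; exact/fsubsetP/fsubsetUr.
- case/andP: up => up uq.
  move: di; rewrite geq_max => /andP[dp dq].
  case: sp => [sp|sq].
    case: (IHp i dA A v) => //.
    + exact: leq_trans (leq_addr _ _) wk.
    + by move=> x xp; apply: vd; rewrite inE xp.
    move=> W [WA cW Wg]; exists W; split=> //; last by left; apply: Wg.
    exact: leq_trans (leq_addr _ _).
  case: (IHq i dA A v) => //.
  + exact: leq_trans (leq_addl _ _) wk.
  + by move=> x xp; apply: vd; rewrite inE xp orbT.
  move=> W [WA cW Wg]; exists W; split=> //; last by right; apply: Wg.
  exact: leq_trans (leq_addl _ _).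
- case: sp => c cA sp; case: (IH i dA A [eta v with x |-> c]) => //.
  + exact: ltnW.
  + move=> y yp /=; case: eqVneq => // yx; apply: vd.
    by rewrite !inE yx.
  move=> W [WA cW Wg]; exists (c |` W); split.
  + by move=> d; rewrite !inE => /orP[/eqP->|/WA].
  + by rewrite cardfsU1 -add1n leq_add // leq_b1.
  move=> dB B g SB dB0 lh; exists (g c).
    by case: lh => gd _ _; apply: gd; rewrite fset1U1.
  have := Wg _ _ _ SB dB0 (local_homS (fsubsetP (fsubsetUr _ _)) lh).
  by apply sat_ext => y yp /=; case: eqVneq.
Qed.

(** A witness set of the sentence, enlarged by [a], is moved into [B] by [tp_extend]. The added
    element is why the width is bounded by [k] rather than [k.+1]. *)
Lemma sentence_transfer S k i phi dA A a dB B b :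
  UNFO phi -> depth phi <= i -> width phi <= k ->
  instance_over S A -> instance_over S B -> a \in dA -> dB != fset0 ->
  tp S k i.+1 dA A a = tp S k i.+1 dB B b ->
  (forall v, sat dA A v phi) -> forall v, sat dB B v phi.
Proof.
move=> [sphi uphi] di wk SA SB adA dB0 e Aphi v.
have [|x||W [WA cW Wg]] :=
  @sat_witness S k phi i dA A v uphi di (leqW wk) SA => //.
- by apply/fset0Pn; exists a.
- by rewrite sphi inE.
have [|||g _ lh] := @tp_extend S k i (a |` W) _ _ _ _ _ _ SA e.
- exact: fset1U1.
- by move=> c; rewrite !inE => /orP[/eqP->|/WA].
- by rewrite cardfsU1 -add1n leq_add ?leq_b1 // (leq_trans cW).
have := Wg _ _ _ SB dB0 (local_homS (fsubsetP (fsubsetUr _ _)) lh).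
exact: sentence_sat.
Qed.

(** * Gluing countermodels along the data *)

Section Gluing.

Variables (S : schema) (k N : nat) (D : instance).
Variables (dB : const -> {fset const}) (B : const -> instance).
(** The element [r d] of [B d] is the one to be identified with the data element [d]. *)
Variable r : const -> const.

Hypothesis k_gt0 : 0 < k.
Hypothesis DS : instance_over S D.
Hypothesis BS : forall d, d \in adom D -> instance_over S (B d).
Hypothesis r_dB : forall d, d \in adom D -> r d \in dB d.
Hypothesis r_adom : forall d, d \in adom D -> r d \in adom (B d).

(** Such a [C] mediates between the models [B x] for [x] in [X]: types let small parts move from
    each of them into [C], and from [C] into each of them. *)
Definition realizes (X dC : {fset const}) (C : instance) (g : const -> const) :=
  [/\ forall x, x \in X -> g x \in dC,
      forall x, x \in X ->
        tp S k N.+1 (dB x) (B x) (r x) = tp S k N.+1 dC C (g x) &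
      forall f, f \in D -> {subset atom_args f <= X} -> atom_map g f \in C].

Hypothesis realizable : forall X : {fset const},
  {subset X <= adom D} -> #|` X| <= k.+1 ->
  exists dC C g, instance_over S C /\ realizes X dC C g.

Definition fresh_bound : nat := (\max_(c <- adom D) c).+1.

(** Apart from the root, elements are coded by numbers above all data constants, the code containing
    [d]; so distinct copies meet neither each other nor the data elsewhere. *)
Definition glue_in (d c : const) : const :=
  if c == r d then d else (fresh_bound + choice.pickle (d : nat, c : nat))%N.

(** With [local], this inverts [glue_in]; the default 0 is returned only for numbers that code
    nothing. *)
Definition owner (m : const) : const :=
  if m < fresh_bound then m else 
  oapp (@fst nat nat) 0 (choice.unpickle (m - fresh_bound)).

Definition local (m : const) : const :=
  if m < fresh_bound then r m else 
  oapp (@snd nat nat) 0 (choice.unpickle (m - fresh_bound)).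

Lemma adom_lt_fresh d : d \in adom D -> d < fresh_bound.
Proof. by move=> dD; rewrite ltnS; exact: leq_bigmax_seq. Qed.

Lemma owner_in d c : d \in adom D -> owner (glue_in d c) = d.
Proof.
move=> dD; rewrite /owner /glue_in; case: eqP => _.
  by rewrite adom_lt_fresh.
by rewrite ltnNge leq_addr /= addKn choice.pickleK.
Qed.

Lemma local_in d c : d \in adom D -> local (glue_in d c) = c.
Proof.
move=> dD; rewrite /local /glue_in; case: eqP => [->|_].
  by rewrite adom_lt_fresh.
by rewrite ltnNge leq_addr /= addKn choice.pickleK.
Qed.

Lemma owner_adom d : d \in adom D -> owner d = d.
Proof. by move=> dD; rewrite /owner adom_lt_fresh. Qed.

Lemma local_adom d : d \in adom D -> local d = r d.
Proof. by move=> dD; rewrite /local adom_lt_fresh. Qed.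

Lemma glue_in_root d : glue_in d (r d) = d.
Proof. by rewrite /glue_in eqxx. Qed.

Definition glued_dom : {fset const} :=
  \bigcup_(d <- adom D) [fset glue_in d c | c in dB d].

Definition glued : instance :=
  D `|` \bigcup_(d <- adom D) [fset atom_map (glue_in d) f | f in B d].

Lemma glued_domP m : m \in glued_dom ->
  [/\ owner m \in adom D, local m \in dB (owner m) &
      glue_in (owner m) (local m) = m].
Proof.
rewrite /glued_dom in_bigfcup => /hasP[d dD /imfsetP[c /= cd ->]].
by rewrite owner_in ?local_in.
Qed.

Lemma glue_in_dom d c : d \in adom D -> c \in dB d ->
  glue_in d c \in glued_dom.
Proof.
move=> dD cd; rewrite /glued_dom in_bigfcup; apply/hasP; exists d => //.
by apply/imfsetP; exists c.
Qed.

Lemma adom_glued_dom d : d \in adom D -> d \in glued_dom.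
Proof.
by move=> dD; rewrite -(glue_in_root d); apply: glue_in_dom; rewrite ?r_dB.
Qed.

Lemma gluedP f : f \in glued ->
  f \in D \/ exists d f', [/\ d \in adom D, f' \in B d &
                             f = atom_map (glue_in d) f'].
Proof.
rewrite inE => /orP[->|]; first by left.
rewrite in_bigfcup => /hasP[d dD /imfsetP[f' /= f'B ->]]; right.
by exists d, f'.
Qed.

Lemma sub_glued : D `<=` glued.
Proof. exact: fsubsetUl. Qed.

Lemma glue_in_fact d f : d \in adom D -> f \in B d ->
  atom_map (glue_in d) f \in glued.
Proof.
move=> dD fB; rewrite inE in_bigfcup; apply/orP; right.
by apply/hasP; exists d => //; apply/imfsetP; exists f.
Qed.

Lemma glued_over : instance_over S glued.
Proof.
move=> f /gluedP[/DS//|[d [f' [dD f'B ->]]]].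
by rewrite atom_map_sym; exact: (BS dD).
Qed.

Lemma adom_glued : (forall d, d \in adom D -> adom (B d) `<=` dB d) ->
  adom glued `<=` glued_dom.
Proof.
move=> BdB; apply/fsubsetP => c /adomP[f /gluedP[fD cf|]].
  by apply: adom_glued_dom; apply/adomP; exists f.
move=> [d [f' [dD f'B ->]]] /mapP[c' c'f ->]; apply: glue_in_dom => //.
by apply: (fsubsetP (BdB d dD)); apply/adomP; exists f'.
Qed.

(* A fact without arguments is shared by the whole glued structure, so its
   presence in one B d has to force it in all of them. *)
Lemma nullary_agree d e f : d \in adom D -> e \in adom D ->
  atom_args f = [::] -> f \in B d -> f \in B e.
Proof.
move=> dD eD fnil fd.
(* A set of two elements is allowed because [k] is positive; the fact passes from [B d] to the
   common model [C] and from there to [B e]. *)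
have [x||dC [C [g [CS [gd gt _]]]]] := @realizable [fset d; e].
- by rewrite !inE => /orP[]/eqP->.
- by rewrite cardfs2 ltnS; case: eqP.
have dX : d \in [fset d; e] by rewrite !inE eqxx.
have eX : e \in [fset d; e] by rewrite !inE eqxx orbT.
have fC : f \in C := tp_nullary (BS dD) (r_dB dD) (gt d dX) fnil fd.
exact: tp_nullary CS (gd e eX) (esym (gt e eX)) fnil fC.
Qed.

(** The piece of [W] owned by [e] moves to [C] by a map of its own that sends [r e] to [g e]. The
    pieces fit together because a glued fact is either a data fact, on which all these maps act like
    [g], or lies in a single copy. *)
Lemma glued_local_hom i (W X dC : {fset const}) C g : i <= N ->
  (forall d c, d \in adom D -> c \in dB d ->
     tp S k i glued_dom glued (glue_in d c) = tp S k i (dB d) (B d) c) ->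
  {subset W <= glued_dom} -> W != fset0 ->
  (forall m, m \in W ->
     #|` owner m |` [fset x in W | owner x == owner m]| <= k.+1) ->
  instance_over S C -> realizes X dC C g ->
  (forall m, m \in W -> owner m \in X) ->
  exists2 g1, local_hom S k i W glued_dom glued dC C g1 &
    forall m, m \in W -> m \in adom D -> g1 m = g m.
Proof.
move=> iN IH WM W0 cW SC [gd gt gf] WX.
(* The element [e] is added to its piece so that the map on the piece can start at [r e]. *)
pose part e := [fset local x | x in e |` [fset x in W | owner x == e]].
have /choice[ge geP] : forall e, exists ge : const -> const,
    e \in [fset owner m | m in W] ->
    ge (r e) = g e /\ local_hom S k i (part e) (dB e) (B e) dC C ge.
  move=> e.
  have [/imfsetP[m /= mW ->]|nW] := boolP (e \in [fset owner m | m in W]); last first.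
    by exists id.
  have [eD mB mE] := glued_domP (WM m mW).
  have [||||ge gee lh] := @tp_extend S k i (part (owner m)) (dB (owner m)) dC
    (B (owner m)) C (r (owner m)) (g (owner m)) (BS eD).
  - exact: tp_le (iN : i < N.+1) (BS eD) (r_dB eD) (gt _ (WX _ mW)).
  - apply/imfsetP; exists (owner m); rewrite ?local_adom //=.
    exact: fset1U1.
  - move=> c /imfsetP[x /=]; rewrite !inE => /orP[/eqP->|/andP[xW /eqP xm]] ->.
      by rewrite local_adom ?r_dB.
    by have [_ + _] := glued_domP (WM x xW); rewrite xm.
  - by rewrite (leq_trans (leq_imfset_card _ _ _)) //; exact: cW.
  by exists ge.
exists (fun m => ge (owner m) (local m)).
  have inpart m : m \in W -> local m \in part (owner m).
    by move=> mW; apply/imfsetP; exists m; rewrite // !inE mW eqxx orbT.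
  have own m : m \in W -> owner m \in [fset owner m | m in W].
    by move=> mW; apply/imfsetP; exists m.
  split=> [m mW|m mW|f].
  - by have [_ [ged _ _]] := geP _ (own m mW); exact/ged/inpart.
  - have [_ [_ get _]] := geP _ (own m mW); rewrite get ?inpart //.
    have [oD lB mE] := glued_domP (WM m mW).
    by rewrite -IH // mE.
  - move=> /gluedP[fD fW|[d [f' [dD f'B ->]]] fW].
      rewrite (@eq_in_atom_map _ _ _ g); last first.
        move=> m mf; have mD : m \in adom D by apply/adomP; exists f.
        have mW := fW m mf; have [+ _] := geP _ (own m mW).
        by rewrite owner_adom // local_adom.
      apply: gf => // m mf; have mW := fW m mf.
      by rewrite -(@owner_adom m) ?WX //; apply/adomP; exists f.
    rewrite atom_map_comp (@eq_in_atom_map _ _ _ (ge d)); last first.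
      by move=> c _ /=; rewrite owner_in ?local_in.
    case f'nil : (atom_args f') => [|c0 cs].
      (* A fact without arguments belongs to no particular piece; it is first moved to the model
         owned by some element of [W], hence the hypothesis that [W] is nonempty. *)
      have [m mW] : exists m, m \in W by apply/fset0Pn.
      rewrite atom_map_id_in ?f'nil //.
      have [oD _ _] := glued_domP (WM m mW).
      apply: (tp_nullary (BS oD) (r_dB oD) (gt _ (WX _ mW)) f'nil).
      exact: nullary_agree dD oD f'nil f'B.
    have c0W : glue_in d c0 \in W.
      by apply: fW; rewrite atom_map_args f'nil mem_head.
    have dW := own _ c0W; rewrite owner_in // in dW.
    have [_ [_ _ gef]] := geP _ dW; apply: gef => // c cf.
    have cW' : glue_in d c \in W by apply: fW; rewrite atom_map_args map_f.
    by have := inpart _ cW'; rewrite owner_in ?local_in.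
move=> m mW mD.
have mO : owner m \in [fset owner m | m in W] by apply/imfsetP; exists m.
have [+ _] := geP _ mO.
by rewrite owner_adom ?local_adom.
Qed.

(** Induction on the depth. Patterns of [B d] survive in its copy; conversely, a pattern of the
    glued structure at an element of that copy is folded back into [B d], the induction hypothesis
    controlling the types of its points. *)
Lemma glued_tp i d c : i <= N.+1 -> d \in adom D -> c \in dB d ->
  tp S k i glued_dom glued (glue_in d c) = tp S k i (dB d) (B d) c.
Proof.
elim: i d c => [|i IH] d c iN dD cd.
  apply/idP/idP => [/adomP[f /gluedP[fD cf|[e [f' [eD f'B ->]]]]]|].
  (* Only the root of the copy can occur in a data fact, and the root is active in [B d] already. *)
  - have : glue_in d c \in adom D by apply/adomP; exists f.
    move=> mD; have := owner_in c dD; rewrite owner_adom // => e.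
    by have := local_in c dD; rewrite local_adom // e => <-; exact: r_adom.
  - rewrite atom_map_args => /mapP[c' c'f e'].
    have := owner_in c dD; have := local_in c dD.
    rewrite e' local_in ?owner_in // => <- <-.
    by apply/adomP; exists f'.
  - by apply: adom_map => f; exact: glue_in_fact.
have {}IH := IH _ _ (ltnW iN).
apply/setP => p; rewrite !inE; apply: asbool_equiv_eq; split; last first.
  move=> [h [h0 hd hf ht]]; exists (glue_in d \o h); split=> [|x|f fp|x] /=.
  - by rewrite h0.
  - exact: glue_in_dom.
  - by rewrite -pfact_map_comp; apply: glue_in_fact => //; exact: hf.
  - exact: etrans (ht x) (esym (IH d (h x) dD (hd x))).
move=> [h [h0 hd hf ht]].
pose W := [fset h x | x in 'I_k.+1].
have hW x : h x \in W by apply/imfsetP; exists x.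
(* It suffices to fold the set of points of the pattern into [B d]. *)
suff [g [gd gm gf gt]] : exists g : const -> const,
    [/\ forall m, m \in W -> g m \in dB d, g (h ord0) = c,
    forall f, f \in glued -> {subset atom_args f <= W} -> atom_map g f \in B d &
    forall m, m \in W ->
      tp S k i (dB d) (B d) (g m) = tp S k i glued_dom glued m].
  exists (g \o h); split=> [//|x|f fp|x] /=; first exact: gd.
    rewrite -pfact_map_comp; apply: gf; first exact: hf.
    by move=> _ /mapP[x _ ->].
  exact: etrans (ht x) (esym (gt _ (hW x))).
have WM : {subset W <= glued_dom} by move=> _ /imfsetP[x _ ->]; exact: hd.
have cW : #|` W| <= k.+1.
  by rewrite (leq_trans (leq_imfset_card _ _ _)) // -cardE card_ord.
have mW : glue_in d c \in W by rewrite -h0.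
(* The part of [W] in B d stays in place; the rest is moved to a model C realizing
   the elements of D involved, and from there into B d. *)
pose V := d |` [fset m in W | owner m != d].
have VM : {subset V <= glued_dom}.
  move=> m; rewrite !inE => /orP[/eqP->|/andP[/WM]//].
  exact: adom_glued_dom.
(* The element [glue_in d c] of [W] is owned by [d], so at most [k] elements have another owner,
   which leaves room for [d] in [V]. *)
have cV0 : #|` [fset m in W | owner m != d]| <= k.
  rewrite -ltnS; apply: leq_trans cW; rewrite (cardfsD1 (glue_in d c) W) mW.
  rewrite add1n ltnS; apply: fsubset_leq_card; apply/fsubsetP => m.
  rewrite !inE => /andP[-> /eqP om]; rewrite andbT.
  by apply/eqP => mE; apply: om; rewrite mE owner_in.
have cV : #|` V| <= k.+1.
  by rewrite cardfsU1 -add1n leq_add ?leq_b1.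
have [||dC [C [g [CS Cg]]]] := @realizable [fset owner m | m in V].
- by move=> _ /imfsetP[m /= mV ->]; case: (glued_domP (VM m mV)).
- by rewrite (leq_trans (leq_imfset_card _ _ _)).
have [||||g1 lh1 g1g] := @glued_local_hom i V _ dC C g _ IH VM _ _ CS Cg _.
- by [].
- by apply/fset0Pn; exists d; exact: fset1U1.
- move=> m; rewrite !inE => /orP[/eqP->|/andP[mW' od]].
    rewrite owner_adom // (_ : _ |` _ = [fset d]) ?cardfs1 //.
    apply/fsetP => x; rewrite !inE; case: eqP => //= _.
    by case: eqP; rewrite ?andbF.
  rewrite cardfsU1 -add1n leq_add ?leq_b1 //; apply: leq_trans cV0.
  apply: fsubset_leq_card; apply/fsubsetP => x; rewrite !inE.
  move=> /andP[/orP[/eqP->|/andP[-> ->]//]].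
  by rewrite owner_adom // eq_sym (negPf od).
- by move=> m mV; apply/imfsetP; exists m.
have dV : d \in V by rewrite fset1U1.
have g1d : g1 d = g d by rewrite g1g.
case: Cg => gd gt _; case: lh1 => g1d' g1t g1f.
have := gt (owner d) (in_imfset _ _ dV); rewrite owner_adom // => dt.
(* Since [g d] has in [C] the type of [r d] in [B d], the image of [V] moves on into [B d] with
   [g d] going to [r d]. *)
have [||||g2 g2d [g2d' g2t g2f]] := @tp_extend S k i [fset g1 m | m in V]
  dC (dB d) C (B d) (g d) (r d) CS.
- exact/esym/(tp_le iN (BS dD) (r_dB dD) dt).
- by apply/imfsetP; exists d.
- by move=> _ /imfsetP[m /= mV ->]; exact: g1d'.
- by rewrite (leq_trans (leq_imfset_card _ _ _)).
have inV m : m \in W -> owner m != d -> m \in V.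
  by move=> ? ?; rewrite !inE; apply/orP; right; apply/andP.
have g1V m : m \in V -> g1 m \in [fset g1 m | m in V].
  by move=> mV; apply/imfsetP; exists m.
(* The two pieces can share only [d], and both maps send it to [r d]. *)
exists (fun m => if owner m == d then local m else g2 (g1 m)); split.
- move=> m mW'; case: eqP => [<-|/eqP od].
    by case: (glued_domP (WM m mW')).
  exact/g2d'/g1V/inV.
- by rewrite h0 owner_in // eqxx local_in.
- move=> f fM fW.
  (* Facts that touch the copy of [B d] at most in [d] are handled by the route through [C]: these
     are the data facts and the facts of other copies. *)
  have other : {subset atom_args f <= V} ->
      {in atom_args f, forall m, owner m == d -> m = d} ->
      atom_map (fun m => if owner m == d then local m else g2 (g1 m)) f \in B d.
    move=> fV fd; rewrite (@eq_in_atom_map _ _ _ (g2 \o g1)); last first.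
      move=> m mf; case: ifP => //= /(fd m mf) ->.
      by rewrite g1d g2d local_adom.
    rewrite -atom_map_comp; apply: g2f; first exact: g1f.
    by move=> _ /mapP[m mf ->]; exact/g1V/fV.
  case/gluedP: (fM) => [fD|[e [f' [eD f'B fE]]]].
    have fd m : m \in atom_args f -> owner m = m.
      by move=> mf; apply: owner_adom; apply/adomP; exists f.
    apply: other => m mf; last by rewrite fd // => /eqP.
    have [->//|md] := eqVneq m d; apply: inV; first exact: fW.
    by rewrite fd.
  have [ed|ed] := eqVneq e d.
    rewrite fE atom_map_comp atom_map_id_in -?ed // => x _ /=.
    by rewrite owner_in // eqxx local_in.
  have fd m : m \in atom_args f -> owner m != d.
    by rewrite fE => /mapP[x _ ->]; rewrite owner_in.
  apply: other => m mf; last by move/negP: (fd m mf).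
  by apply: inV; [exact: fW|exact: fd].
- move=> m mW'; case: eqP => [<-|/eqP od].
    have [oD lB mE] := glued_domP (WM m mW').
    by rewrite -IH // mE.
  by rewrite g2t ?g1t ?g1V ?inV.
Qed.

End Gluing.

Lemma leq_sumn_map (T : Type) (f : T -> nat) s x :
  List.In x s -> f x <= sumn (map f s).
Proof.
elim: s => //= y s IH [->|/IH]; first exact: leq_addr.
by move=> xs; exact: leq_trans xs (leq_addl _ _).
Qed.

Lemma Forall_map_in (T : eqType) U (f : T -> U) (P : U -> Prop) s :
  List.Forall P (map f s) <-> forall x, x \in s -> P (f x).
Proof.
elim: s => [|x s IH] /=; first by split.
rewrite List.Forall_cons_iff IH; split=> [[Px H] y|H].
  by rewrite inE => /orP[/eqP->|/H].
by split=> [|y ys]; apply: H; rewrite ?mem_head // inE ys orbT.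
Qed.

Lemma mem_adom_arg (D : instance) f c :
  f \in D -> c \in atom_args f -> c \in adom D.
Proof. by move=> fD cf; apply/adomP; exists f. Qed.

Lemma ucq_unfo phi : is_ucq phi -> unfo phi /\ depth phi = 0.
Proof.
have conj p : is_atom_conj p -> unfo p /\ depth p = 0.
  elim: p => //= p IHp q IHq /andP[/IHp[-> ->] /IHq[-> ->]].
  by rewrite maxn0.
have cq p : is_cq p -> unfo p /\ depth p = 0.
  by elim: p => //= p IHp q IHq cpq; exact: (conj (And p q)).
elim: phi => //= [p _ q _|p IHp q IHq|x p _]; [exact: (cq (And p q))| |exact: cq].
by move=> /andP[/IHp[-> ->] /IHq[-> ->]]; rewrite maxn0.
Qed.

(** * From ontology-mediated queries to programs *)

Section Program.

Variables (S : schema) (O : seq formula) (n : nat).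
Variables (xs : n.-tuple var) (phi : formula).

Definition full_schema : schema := S `|` ontology_sig O.
Local Notation T := full_schema.

Definition answers_on : instance -> n.-tuple const -> Prop :=
  certain_answers (fo_query (S `|` ontology_sig O) xs phi).

(** Bounds the width of each ontology sentence, and leaves room for a witness set of the query
    together with the answer constants and one further element. *)
Definition type_width : nat := (sumn (map width O) + width phi + n).+1.
Local Notation k := type_width.

Definition type_depth : nat := sumn (map depth O).
Local Notation N := type_depth.

(** One level more than the depth of the ontology, because moving a set by [tp_extend] costs a
    level. *)
Definition label : finType := typ T k N.+1.

Definition label_of (dom : {fset const}) (B : instance) (c : const) : label :=
  tp T k N.+1 dom B c.

(** Room for [k.+1] data elements and the [n] answer constants. *)
Definition pattern_size : nat := (k + n).+1.
Local Notation m := pattern_size.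

Definition fresh_name : nat := (\max_(R <- S) R.1).+1.
Definition goal_sym : symbol := (fresh_name, n).
(** The successor keeps these names above that of the goal, so that the symbols differ even when [n]
    is 1. *)
Definition label_sym (t : label) : symbol :=
  ((fresh_name + choice.pickle t).+1, 1).

Definition goal_atom U (a : n.-tuple U) : atom U := mk_atom (R := goal_sym) a.
Definition label_atom U (t : label) (x : U) : atom U :=
  mk_atom (R := label_sym t) [tuple x].

Definition generic_atom (R : symbol) : atom var :=
  mk_atom (R := R) [tuple (i : nat) | i < arity R].

(** No countermodel realizes the pattern. The condition is semantic and selects goal rules
    classically; the finite set of candidates keeps the program finite. *)
Definition entails (p : {set pfact S m} * {ffun 'I_m -> label})
    (s : n.-tuple 'I_m) : Prop :=
  forall dom B (h : 'I_m -> const), is_structure T dom B -> models dom B O ->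
  (forall f, f \in p.1 -> pfact_map h f \in B) ->
  (forall j, h j \in adom B /\ label_of dom B (h j) = p.2 j) ->
  fo_answers xs phi B (map_tuple h s).

(** One rule for each argument position, so that every data element is assigned some label. *)
Definition choice_rule (Ri : {R : S & 'I_(arity (fsval R))}) : rule :=
  Rule [seq label_atom t (tagged Ri : nat) | t <- enum label]
       [:: generic_atom (fsval (tag Ri))].

(* Puts all labels into the IDB and all of [S] into the EDB schema. *)
Definition keep_rule (t : label) : rule :=
  Rule [:: label_atom t 0]
       (label_atom t 0 :: [seq generic_atom R | R <- enum_fset S]).

Definition goal_rule (p : {set pfact S m} * {ffun 'I_m -> label} * n.-tuple 'I_m)
    : rule :=
  Rule [:: goal_atom (map_tuple (@nat_of_ord m) p.2)]
       ([seq label_atom (p.1.2 j) (j : nat) | j <- enum 'I_m] ++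
        [seq pfact_map (@nat_of_ord m) f | f <- enum p.1.1]).

(* The argument-free facts of [Z] serve as atoms, [const] and [var] both
   being [nat]. *)
Definition nullary_rule (Z : instance) : rule :=
  Rule [:: goal_atom (nseq_tuple n 0)] (enum_fset Z).

(* Data without constants have no element to carry a type and are treated by
   rules of their own. *)
Definition nullary_facts : instance := instance_of S fset0 (fun=> True).

Definition omq_program : program :=
  Program ([seq choice_rule Ri | Ri <- enum {: {R : S & 'I_(arity (fsval R))}}] ++
           [seq keep_rule t | t <- enum label] ++
           [seq goal_rule p | p <- enum {: {set pfact S m} *
                {ffun 'I_m -> label} * n.-tuple 'I_m} & `[< entails p.1 p.2 >]] ++
           [seq nullary_rule Z | Z <- enum_fset (fpowerset nullary_facts) &
              (Z != fset0) && `[< exists a, answers_on Z a >]])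
          goal_sym.
Local Notation Pi := omq_program.

Lemma omq_rulesP (P : rule -> Prop) :
  List.Forall P (rules Pi) <->
  [/\ forall Ri, P (choice_rule Ri), forall t, P (keep_rule t),
      forall p, entails p.1 p.2 -> P (goal_rule p) &
      forall Z a, Z `<=` nullary_facts -> Z != fset0 -> answers_on Z a ->
        P (nullary_rule Z)].
Proof.
rewrite !List.Forall_app !Forall_map_in.
split=> [[H1 [H2 [H3 H4]]]|[H1 H2 H3 H4]]; repeat split.
- by move=> Ri; apply: H1; rewrite mem_enum.
- by move=> t; apply: H2; rewrite mem_enum.
- by move=> p ep; apply: H3; rewrite mem_filter mem_enum andbT; apply/asboolP.
- move=> Z a ZS Z0 ca; apply: H4; rewrite mem_filter Z0 fpowersetE ZS andbT /=.
  by apply/asboolP; exists a.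
- by move=> Ri _; exact: H1.
- by move=> t _; exact: H2.
- by move=> p; rewrite mem_filter => /andP[/asboolP /H3].
- move=> Z; rewrite mem_filter fpowersetE => /andP[/andP[Z0 /asboolP[a ca]] ZS].
  exact: H4 ca.
Qed.

(** * Schema and well-formedness of the program *)

Lemma name_lt_fresh R : R \in S -> R.1 < fresh_name.
Proof.
move=> RS; rewrite ltnS.
exact: (@leq_bigmax_seq _ _ xpredT (fun R : symbol => R.1)).
Qed.

Lemma goal_notin : goal_sym \notin S.
Proof. by apply/negP => /name_lt_fresh; rewrite ltnn. Qed.

Lemma label_notin t : label_sym t \notin S.
Proof.
by apply/negP => /name_lt_fresh; rewrite ltnNge /= ltnW // ltnS leq_addr.
Qed.

Lemma label_goal t : (label_sym t == goal_sym) = false.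
Proof.
apply/eqP => -[e _]; have := leq_addr (choice.pickle t) fresh_name.
by rewrite -ltnS e ltnn.
Qed.

Lemma label_sym_inj : injective label_sym.
Proof. by move=> t u [] /eqP; rewrite eqn_add2l => /eqP /(pcan_inj choice.pickleK). Qed.

Lemma nullary_answer Z a : Z `<=` nullary_facts -> answers_on Z a -> n = 0.
Proof.
move=> /fsubsetP ZS [aZ _]; apply/eqP; rewrite -leqn0 leqNgt; apply/negP => n0.
have /adomP[f /ZS /instance_ofP[_ fE _] /fE] := aZ _ (mem_tnth (Ordinal n0) a).
by rewrite inE.
Qed.

Definition idb_sym R : Prop := R = goal_sym \/ exists t, R = label_sym t.

Lemma omq_head_syms R : R \in head_syms Pi -> idb_sym R.
Proof.
rewrite /head_syms in_bigfcup => /has_inP[r rP]; move: r rP.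
apply/List.Forall_forall/omq_rulesP; split=> [Ri|t|p _|Z a _ _ _];
  rewrite in_atoms_syms /=.
- by rewrite -map_comp => /mapP[t _ ->]; right; exists t.
- by rewrite inE => /eqP->; right; exists t.
- by rewrite inE => /eqP->; left.
- by rewrite inE => /eqP->; left.
Qed.

Lemma omq_body_syms R : R \in body_syms Pi -> R \in S \/ exists t, R = label_sym t.
Proof.
rewrite /body_syms in_bigfcup => /has_inP[r rP]; move: r rP.
apply/List.Forall_forall/omq_rulesP; split=> [Ri|t|p _|Z a ZS _ _];
  rewrite in_atoms_syms /=.
- by rewrite inE => /eqP->; left; exact: valP.
- rewrite inE => /orP[/eqP->|]; first by right; exists t.
  by rewrite -map_comp => /mapP[R' RS ->]; left.
- rewrite map_cat mem_cat -!map_comp => /orP[]/mapP[x _ ->].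
    by right; exists (p.1.2 x).
  by left; exact: valP.
- case/mapP => f fZ ->; left.
  by have /instance_ofP[] := fsubsetP ZS f fZ.
Qed.

Lemma rule_syms (F : rule -> seq (atom var)) r R :
  List.In r (rules Pi) -> R \in map (@atom_sym var) (F r) ->
  R \in \bigcup_(r <- rules Pi) atoms_syms (F r).
Proof.
by move=> rP RF; rewrite in_bigfcup; apply/has_inP; exists r; rewrite ?in_atoms_syms.
Qed.

Lemma omq_rules_in :
  [/\ forall Ri, List.In (choice_rule Ri) (rules Pi),
      forall t, List.In (keep_rule t) (rules Pi),
      forall p, entails p.1 p.2 -> List.In (goal_rule p) (rules Pi) &
      forall Z a, Z `<=` nullary_facts -> Z != fset0 -> answers_on Z a ->
        List.In (nullary_rule Z) (rules Pi)].
Proof.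
apply: (iffLR (omq_rulesP (fun r => List.In r (rules Pi)))).
exact/List.Forall_forall.
Qed.

Lemma label_idb t : label_sym t \in idb Pi.
Proof.
by case: omq_rules_in => _ H _ _; apply: rule_syms (H t) _; rewrite inE.
Qed.

Lemma omq_edb : edb Pi = S.
Proof.
apply/fsetP => R; rewrite !inE; apply/andP/idP => [[Rh]|RS].
  rewrite (negPf Rh) => /omq_body_syms[//|[t Rt]].
  by rewrite Rt label_idb in Rh.
split.
  by apply/negP => /omq_head_syms[|[t]] e; move: RS;
    rewrite e (negPf goal_notin, negPf (label_notin _)).
(* Any label serves here, as each keep rule mentions all of [S]. *)
apply/orP; right; pose t : label := set0.
case: omq_rules_in => _ H _ _; apply: rule_syms (H t) _ => /=.
by rewrite inE -map_comp; apply/orP; right; apply/mapP; exists R.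
Qed.

Lemma omq_mddlog : is_mddlog Pi.
Proof.
split; last first.
  by move=> R /omq_head_syms[->|[t ->]] //; rewrite eqxx.
have goal_body r : List.In r (rules Pi) -> goal_sym \notin atoms_syms (rule_body r).
  move=> rP; apply/negP; rewrite in_atoms_syms => /(rule_syms rP).
  case/omq_body_syms => [|[t /eqP]]; first exact/negP/goal_notin.
  by rewrite eq_sym label_goal.
apply/List.Forall_forall => r rP; split; [|exact: goal_body|]; move: r rP;
  apply/List.Forall_forall/omq_rulesP; split=> [Ri|t|p _|Z a ZS Z0 aZ] //.
- split=> //; apply/fsubsetP => x; rewrite !in_atoms_vars /= orbF.
  move=> /hasP[_ /mapP[t _ ->]]; rewrite inE => /eqP->.
  by apply/mapP; exists (tagged Ri); rewrite ?mem_enum.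
- split=> //; apply/fsubsetP => x; rewrite !in_atoms_vars /= orbF.
  by move=> ->.
- split; first by rewrite /= enum_ordSl.
  apply/fsubsetP => x; rewrite !in_atoms_vars /= orbF has_cat => /mapP[j _ ->].
  apply/orP; left; apply/hasP; exists (label_atom (p.1.2 j) (j : nat)).
    by apply/mapP; exists j; rewrite ?mem_enum.
  by rewrite inE.
- split; first by move/eqP; rewrite -size_eq0 cardfs_eq0 (negPf Z0).
  apply/fsubsetP => x; rewrite !in_atoms_vars /= orbF.
  by have n0 := nullary_answer ZS aZ; rewrite /atom_args /= mem_nseq n0.
- rewrite in_atoms_syms /= -map_comp => /mapP[t _ /eqP].
  by rewrite eq_sym label_goal.
Qed.

(** * Correctness of the program *)

Lemma tuple_eq0 l (t u : l.-tuple const) : l = 0 -> t = u.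
Proof. by move=> l0; subst l; rewrite (tuple0 t) (tuple0 u). Qed.

Lemma label_atom_map U V (h : U -> V) t x :
  atom_map h (label_atom t x) = label_atom t (h x).
Proof. by congr mk_atom; apply: val_inj. Qed.

Lemma edb_sub_full : S `<=` T.
Proof. exact: fsubsetUl. Qed.

Lemma adom_nullary D c : D `<=` nullary_facts -> c \notin adom D.
Proof.
move=> /fsubsetP DS; apply/negP => /adomP[f /DS /instance_ofP[_ fE _] /fE].
by rewrite inE.
Qed.

Lemma nullary_fact_map D h f :
  D `<=` nullary_facts -> f \in D -> atom_map h f = f.
Proof.
move=> DN fD; apply: atom_map_id_in => c cf.
by have := adom_nullary c DN; rewrite (mem_adom_arg fD cf).
Qed.

Lemma generic_atomE R (v : var -> const) (t : (arity R).-tuple const) :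
  (forall i : 'I_(arity R), v i = tnth t i) ->
  atom_map v (generic_atom R) = mk_atom t.
Proof.
by move=> vt; congr mk_atom; apply: eq_from_tnth => i; rewrite tnth_map tnth_mktuple.
Qed.

(** A model of the ontology containing the data dictates how to label them: with the types actually
    realized. Adding the goal facts for its true answers gives a model of the program, which must
    contain [goal_atom a]. *)
Lemma omq_sound D (a : n.-tuple const) : instance_over S D ->
  ddlog_answers (P := Pi) D a -> answers_on D a.
Proof.
move=> DS [aD Da]; split=> // dom B strB modB DB.
have [dom0 BT Bdom] := strB.
pose D' := instance_of (idb Pi `|` edb Pi) (adom D) (fun f =>
  [\/ f \in D,
      exists2 c, c \in adom D & f = label_atom (label_of dom B c) c |
      exists2 b, fo_answers xs phi B b & f = goal_atom b]).
have D'S f : f \in D' -> atom_sym f \in S -> f \in D.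
  case/instance_ofP => _ _ [//|[c _ ->]|[b _ ->]] fS; move: fS.
  - by rewrite (negPf (label_notin _)).
  - by rewrite (negPf goal_notin).
have D'label t c : label_atom t c \in D' ->
    c \in adom D /\ label_of dom B c = t.
  case/instance_ofP => _ _ [/DS|[d dD e]|[b _ e]].
  - by rewrite (negPf (label_notin _)).
  - have := congr1 (@atom_sym _) e => /label_sym_inj te.
    by move: e; rewrite te => /mk_atom_inj /(congr1 val) [->].
  - by have /eqP := congr1 (@atom_sym _) e; rewrite label_goal.
have labelD' c : c \in adom D -> label_atom (label_of dom B c) c \in D'.
  move=> cD; apply/instance_ofP; split.
  - by rewrite inE label_idb.
  - by move=> d; rewrite inE => /eqP->.
  - by apply: Or32; exists c.
have : goal_atom a \in D'; last first.
  case/instance_ofP => _ _ [/DS|[d dD /(congr1 (@atom_sym _)) /eqP]|[b qb e]].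
  - by rewrite (negPf goal_notin).
  - by rewrite eq_sym label_goal.
  - by rewrite (mk_atom_inj e).
have goalD' r b : List.In r (rules Pi) ->
    goal_sym \in map (@atom_sym _) (rule_head r) ->
    {subset b <= adom D} -> fo_answers xs phi B b -> goal_atom b \in D'.
  move=> rP rg bD qb; apply/instance_ofP; split=> //.
    by rewrite inE (rule_syms (F := rule_head) rP rg).
  by apply: Or33; exists b.
apply: Da.
- apply/fsubsetP => f fD; apply/instance_ofP; split.
  + by rewrite inE omq_edb DS ?orbT.
  + by move=> c; exact: mem_adom_arg.
  + exact: Or31.
- by move=> f /instance_ofP[].
case: omq_rules_in => _ _ goalI nullI.
apply/omq_rulesP; split=> [[R i]|t|p ep|Z b ZN Z0 aZ] v /=.
- rewrite andbT => /D'S /(_ (valP R)) RD.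
  have vD : v i \in adom D.
    apply: mem_adom_arg RD _; apply/mapP; exists (i : nat) => //.
    by apply/mapP; exists i; rewrite ?mem_enum.
  apply/hasP; exists (label_atom (label_of dom B (v i)) (i : nat)).
    by apply/mapP; exists (label_of dom B (v i)); rewrite ?mem_enum.
  by rewrite label_atom_map; exact: labelD'.
- by case/andP => -> _.
- rewrite orbF all_cat => /andP[/allP lb /allP fc].
  have vl (j : 'I_m) : v j \in adom D /\ label_of dom B (v j) = p.1.2 j.
    by apply: D'label; rewrite -label_atom_map;
      apply: (lb (label_atom (p.1.2 j) (j : nat)));
      apply/mapP; exists j; rewrite ?mem_enum.
  rewrite (_ : atom_map _ _ = goal_atom
      (map_tuple (fun j : 'I_m => v j) p.2)); last first.
    by congr mk_atom; apply: val_inj; rewrite /= -map_comp.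
  apply: (goalD' _ _ (goalI p ep)); rewrite ?inE //.
    by move=> _ /mapP[j _ ->]; case: (vl j).
  (* The labels are the types in [B], so [B] itself realizes the pattern of the rule and must give
     the answer. *)
  apply: ep strB modB _ _ => [f fp|j].
    rewrite -pfact_map_comp; apply: (fsubsetP DB); apply: D'S; last exact: valP.
    by apply: fc; apply/mapP; exists f; rewrite ?mem_enum.
  by have [vD vt] := vl j; split=> //; exact: adomS vD.
- move=> /allP Zv; rewrite orbF.
  have ZD : Z `<=` D.
    apply/fsubsetP => f fZ; have := Zv f fZ.
    rewrite (nullary_fact_map _ ZN fZ) => /D'S; apply.
    by have /instance_ofP[] := fsubsetP ZN f fZ.
  have n0 := nullary_answer ZN aZ.
  have -> : atom_map v (goal_atom (nseq_tuple n 0)) = goal_atom b.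
    by congr mk_atom; apply: (tuple_eq0 _ _ n0).
  apply: (goalD' _ _ (nullI Z b ZN Z0 aZ)); first by rewrite inE.
    by case: aZ => bZ _ c /bZ /(adomS ZD).
  by case: aZ => _ /(_ dom B strB modB (fsubset_trans ZD DB)).
Qed.
(** One model for each data element is glued to the data. The result inherits the ontology, and a
    match of the query in it would move, with the answer constants, into one of the small
    countermodels. *)
Lemma glued_countermodel D (a : n.-tuple const) (l : const -> label) :
  instance_over S D -> adom D != fset0 -> {subset a <= adom D} ->
  (forall X : {fset const}, {subset X <= adom D} -> #|` X| <= k.+1 ->
    exists dC C g,
    [/\ is_structure T dC C, models dC C O,
        forall x, x \in X \/ x \in a ->
          g x \in adom C /\ label_of dC C (g x) = l x,
        forall f, f \in D -> {subset atom_args f <= X} -> atom_map g f \in C &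
        ~ fo_answers xs phi C (map_tuple g a)]) ->
  is_ucq phi -> {subset free_vars phi <= xs} ->
  List.Forall UNFO O ->
  ~ answers_on D a.
Proof.
move=> DS D0 aD RH uq fvq uO [_ ans].
have /choice[dB /choice[B /choice[r BP]]] : forall d, exists dC C c,
    d \in adom D -> [/\ is_structure T dC C, models dC C O, c \in adom C &
                        label_of dC C c = l d].
  move=> d; have [dD|] := boolP (d \in adom D); last by exists fset0, fset0, 0.
  have [x||dC [C [g [str mod gX _ _]]]] := RH [fset d].
  - by rewrite inE => /eqP->.
  - by rewrite cardfs1.
  by exists dC, C, (g d) => _; have [] := gX d (or_introl (fset11 d)).
have DT : instance_over T D.
  by move=> f /DS; apply: (fsubsetP edb_sub_full).
have BT d : d \in adom D -> instance_over T (B d) by case/BP => -[].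
have BdB d : d \in adom D -> adom (B d) `<=` dB d by case/BP => -[].
have rB d : d \in adom D -> r d \in adom (B d) by case/BP.
have rdB d : d \in adom D -> r d \in dB d.
  by move=> dD; apply: (fsubsetP (BdB d dD)); exact: rB.
have k0 : 0 < k by [].
have realI X dC C g : {subset X <= adom D} -> is_structure T dC C ->
    (forall x, x \in X \/ x \in a ->
       g x \in adom C /\ label_of dC C (g x) = l x) ->
    (forall f, f \in D -> {subset atom_args f <= X} -> atom_map g f \in C) ->
    realizes T k N D dB B r X dC C g.
  move=> XD [_ _ CdC] gX gf; split=> // x xX.
    by apply: (fsubsetP CdC); case: (gX x (or_introl xX)).
  have [_ _ _] := BP x (XD x xX); rewrite /label_of => ->.
  by case: (gX x (or_introl xX)).
have real X : {subset X <= adom D} -> #|` X| <= k.+1 ->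
    exists dC C g, instance_over T C /\ realizes T k N D dB B r X dC C g.
  move=> XD cX; have [dC [C [g [str mod gX gf _]]]] := RH X XD cX.
  by exists dC, C, g; split; [case: str|exact: realI].
pose dM := glued_dom D dB r; pose M := glued D B r.
have MT : instance_over T M by exact: glued_over.
have MdM : adom M `<=` dM by exact: adom_glued.
have [d0 d0D] : exists d, d \in adom D by apply/fset0Pn.
have d0M : d0 \in dM by exact: adom_glued_dom.
have tpM i d c : i <= N.+1 -> d \in adom D -> c \in dB d ->
    tp T k i dM M (glue_in D r d c) = tp T k i (dB d) (B d) c.
  exact: glued_tp.
have strM : is_structure T dM M.
  by split=> //; apply/fset0Pn; exists d0.
have modM : models dM M O.
  apply/List.Forall_forall => psi psiO.
  have [_ /List.Forall_forall/(_ psi psiO) modB _ _] := BP d0 d0D.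
  have UO : UNFO psi by move/List.Forall_forall: uO; apply.
  (* The types of [d0] in the glued structure and of [r d0] in [B d0] agree, so each ontology
     sentence carries over. *)
  apply: (sentence_transfer (k := k) (i := N) UO _ _ (BT d0 d0D) MT (rdB d0 d0D) _ _ modB).
  - exact: (leq_sumn_map depth).
  - apply: leq_trans (leq_sumn_map width psiO) _.
    by rewrite /type_width -addnA -addnS leq_addr.
  - by apply/fset0Pn; exists d0.
  - rewrite -tpM ?rdB //.
have [aM [v va sv]] := ans dM M strM modM (sub_glued D B r).
have vM x : x \in free_vars phi -> v x \in adom M.
  move=> /fvq xx; apply: aM; rewrite -va; exact: map_f.
have va_in x : x \in free_vars phi -> v x \in a.
  move=> /fvq xx; rewrite -va; exact: map_f.
have [uphi dphi] := ucq_unfo uq.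
have AM0 : adom M != fset0.
  by apply/fset0Pn; exists d0; apply: adomS d0D; exact: sub_glued.
have [||W [WM cW Wg]] := @sat_witness T k phi 0 (adom M) M v uphi _ _ MT AM0 vM sv.
- by rewrite dphi.
- apply: leqW; rewrite /type_width -addnA addnCA -addnS; exact: leq_addr.
(* Including [d0] makes [V] nonempty; including the answer constants makes the map into [C] agree
   with [g] on them. *)
pose V := d0 |` W `|` [fset c in val a].
have cV : #|` V| <= k.
  rewrite /V; apply: leq_trans (leq_card_fsetU _ _).1 _.
  have c1 : #|` [fset c in val a]| <= n.
    by have := card_fset_seq (val a); rewrite size_tuple.
  have c2 : #|` d0 |` W| <= (width phi).+1.
    by rewrite cardfsU1 -add1n leq_add ?leq_b1.
  apply: leq_trans (leq_add c2 c1) _.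
  by rewrite /type_width addSn ltnS leq_add2r leq_addl.
have aD_M c : c \in a -> c \in adom D by exact: aD.
have VM : {subset V <= adom M}.
  move=> c; rewrite !inE -orbA => /or3P[/eqP->|/WM//|/aM//].
  by apply: adomS d0D; exact: sub_glued.
have VdM : {subset V <= dM} by move=> c /VM; exact: (fsubsetP MdM).
pose X := [fset owner D m | m in V].
have XD : {subset X <= adom D}.
  by move=> _ /imfsetP[c /= /VdM cM ->]; case: (glued_domP cM).
have [|dC [C [g [strC modC gX gf qC]]]] := RH X XD.
  by rewrite (leq_trans (leq_imfset_card _ _ _)) // (leq_trans cV).
have CT : instance_over T C by case: strC.
have rC := realI X dC C g XD strC gX gf.
have [||m mV|m mV|g1 lh1 g1g] :=
  @glued_local_hom T k N D dB B r k0 BT rdB real N V X dC C g (leqnn N) _ VdM _ _ CT rC _.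
- by move=> d c; apply: tpM.
- by apply/fset0Pn; exists d0; rewrite !inE eqxx.
- rewrite cardfsU1 -add1n leq_add ?leq_b1 //; apply: leq_trans cV.
  apply: fsubset_leq_card; apply/fsubsetP => x; rewrite !inE.
  by case/andP.
- by apply/imfsetP; exists m.
apply: qC; split.
  move=> _ /mapP[c ca ->]; by case: (gX c (or_intror ca)).
exists (g \o v); first by apply: val_inj; rewrite -va /= map_comp.
have WV : {subset W <= V} by move=> c cW'; rewrite !inE cW' orbT.
(* Types determine membership in the active domain, so the map restricts to active domains, over
   which the query is evaluated. *)
have lh0 : local_hom T k 0 W (adom M) M (adom C) C g1.
  have [g1d g1t g1f] := local_homS WV lh1.
  have g1a c : c \in W -> (g1 c \in adom C) = (c \in adom M).
    move=> cW'; apply/esym; apply: (tp_adom (j := N) MT _ (esym (g1t c cW'))).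
    exact/VdM/WV.
  by split=> // c cW'; rewrite /= g1a // WM.
have C0 : adom C != fset0.
  have d0X : d0 \in X.
    by apply/imfsetP; exists d0; rewrite ?owner_adom // !inE eqxx.
  by apply/fset0Pn; exists (g d0); case: (gX d0 (or_introl d0X)).
have := Wg _ _ _ CT C0 lh0; apply sat_ext => x xf /=.
symmetry; apply: g1g; first by rewrite !inE va_in ?orbT.
exact/aD/va_in.
Qed.

(** If a model of the program lacks [goal_atom a], its labels are the guess. Since no goal rule
    fires, each small set of data elements has a countermodel with these labels, and gluing
    contradicts certainty of the answer. *)
Lemma omq_complete D (a : n.-tuple const) : instance_over S D -> D != fset0 ->
  is_ucq phi -> {subset free_vars phi <= xs} -> List.Forall UNFO O ->
  answers_on D a -> ddlog_answers (P := Pi) D a.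
Proof.
move=> DS Dn0 uq fvq uO ans; have [aD _] := ans; split=> // D' DD' D'S sD'.
apply: contrapT => /negP Ga.
have {}Ga : goal_atom a \notin D' by [].
have [rC rK rG rN] := (iffLR (omq_rulesP _) sD').
have DD'f f : f \in D -> f \in D' by exact: fsubsetP.
have [D0|[d0 d0D]] := fset_0Vmem (adom D).
  have DN : D `<=` nullary_facts.
    apply/fsubsetP => f fD; apply/instance_ofP; split=> // [|c cf].
      exact: DS.
    by rewrite -D0; exact: mem_adom_arg cf.
  have := rN D a DN Dn0 ans (fun=> 0); case/(_ _)/orP => //.
    by apply/allP => f fD; rewrite (nullary_fact_map _ DN fD) DD'f.
  rewrite (_ : atom_map _ _ = goal_atom a) ?(negPf Ga) //.
  by congr mk_atom; apply: (tuple_eq0 _ _ (nullary_answer DN ans)).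
have /choice[l lP] : forall d, exists t, d \in adom D -> label_atom t d \in D'.
  move=> d; have [|_] := boolP (d \in adom D); last by exists set0.
  move=> /adomP[[R t] fD /tnthP[i dE]]; have RS := DS _ fD.
  pose v x := nth d t x.
  have := rC (existT _ (FSetSub RS) i) v.
  rewrite /sat_rule /= andbT (generic_atomE (t := t)); last first.
    by move=> j; rewrite /v (tnth_nth d).
  move=> /(_ (DD'f _ fD)) /hasP[_ /mapP[u _ ->]].
  rewrite label_atom_map /= /v -tnth_nth -dE => ?.
  by exists u.
apply: (@glued_countermodel D a l) => //; first by apply/fset0Pn; exists d0.
(* The points of the pattern are the elements of [X] and of [a]; surplus points repeat [d0]. *)
move=> X XD cX; pose s := enum_fset X ++ a.
have sm : size s <= m by rewrite size_cat size_tuple /pattern_size -addSn leq_add2r.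
pose r c : 'I_m := inord (index c s).
pose x (j : 'I_m) := nth d0 s j.
have xD j : x j \in adom D.
  rewrite /x; have [js|?] := ltnP j (size s); last by rewrite nth_default.
  by have := mem_nth d0 js; rewrite mem_cat => /orP[/XD|/aD].
have xr c : c \in s -> x (r c) = c.
  move=> cs; rewrite /x inordK ?nth_index //.
  by apply: leq_trans sm; rewrite index_mem.
pose p : {set pfact S m} * {ffun 'I_m -> label} :=
  ([set f | pfact_map x f \in D], [ffun j => l (x j)]).
pose t := map_tuple r a.
have np : ~ entails p t.
  move=> ep; have := rG (p, t) ep (fun i => nth d0 s i).
  rewrite /sat_rule /= orbF all_cat => H; move/negP: Ga; apply.
  rewrite (_ : goal_atom a = atom_map (fun i => nth d0 s i)
    (goal_atom (map_tuple (@nat_of_ord m) t))).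
    apply: H; apply/andP; split; apply/allP => _ /mapP[j jp ->].
      by rewrite label_atom_map ffunE; apply: lP; exact: xD.
    rewrite pfact_map_comp; apply: DD'f; move: jp.
    by rewrite mem_enum inE.
  congr mk_atom; apply: val_inj; rewrite /= -!map_comp.
  rewrite -[LHS]map_id; apply/eq_in_map => c ca /=.
  by apply/esym/xr; rewrite mem_cat ca orbT.
(* A structure refuting entailment of this pattern is the required countermodel, the data being
   mapped through their points. *)
apply: contrapT => nC; apply: np => dC C h str mod hf hl.
apply: contrapT => nq; apply: nC; exists dC, C, (h \o r); split=> //.
- move=> c cXa; have [hC ht] := hl (r c); split=> //=.
  rewrite ht ffunE xr // mem_cat.
  by case: cXa => ->; rewrite ?orbT.
- move=> f fD fX; have [pf pfE] := pull_fact r (DS f fD).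
  rewrite -(pfE _ h); apply: hf; rewrite inE pfE atom_map_id_in // => c /fX cX'.
  by apply: xr; rewrite mem_cat cX'.
- rewrite (_ : map_tuple _ _ = map_tuple h t) //.
  by apply: val_inj; rewrite /= map_comp.
Qed.
End Program.

(** * From programs to ontology-mediated queries *)

Definition exs (ys : seq var) (p : formula) : formula := foldr Ex p ys.

Definition ands (T : Type) (p : formula) (f : T -> formula) (s : seq T) : formula :=
  foldr (fun x q => And (f x) q) p s.

Lemma sat_exs dom D v ys p :
  sat dom D v (exs ys p) <->
  exists w, [/\ forall x, x \notin ys -> w x = v x,
                forall x, x \in ys -> w x \in dom & sat dom D w p].
Proof.
elim: ys v => [|y ys IH] v /=.
  split=> [sp|[w [wv _ sp]]]; first by exists v.
  by move: sp; apply sat_ext => x _; rewrite wv.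
split=> [[c cd /IH[w [wv wd sp]]]|[w [wv wd sp]]].
  have wy : w y \in dom.
    by have [/wd//|/wv] := boolP (y \in ys); rewrite /= eqxx => ->.
  exists w; split=> // x; rewrite inE; last by case/orP => [/eqP->|/wd].
  by rewrite negb_or => /andP[/negPf xy /wv] /=; rewrite xy.
exists (w y); first by apply: wd; rewrite mem_head.
apply/IH; exists w; split=> // x xys; last by apply: wd; rewrite inE xys orbT.
by rewrite /=; case: eqVneq => [->//|xy]; rewrite wv // inE negb_or xy.
Qed.

Lemma sat_ands (T : eqType) dom D v p (f : T -> formula) s :
  sat dom D v (ands p f s) <->
  sat dom D v p /\ forall x, x \in s -> sat dom D v (f x).
Proof.
elim: s => [|x s IH] /=; first by split=> [sp|[]].
split=> [[fx /IH[sp fs]]|[sp fs]].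
  by split=> // y; rewrite inE => /orP[/eqP->|/fs].
split; first by apply: fs; rewrite mem_head.
by apply/IH; split=> // y ys; apply: fs; rewrite inE ys orbT.
Qed.

Lemma free_vars_exs ys p x :
  (x \in free_vars (exs ys p)) = (x \notin ys) && (x \in free_vars p).
Proof. by elim: ys => //= y ys IH; rewrite !inE IH negb_or andbA. Qed.

Lemma free_vars_ands T p (f : T -> formula) s x :
  (x \in free_vars (ands p f s)) =
  (x \in free_vars p) || has (fun y => x \in free_vars (f y)) s.
Proof. by elim: s => /= [|y s IH]; rewrite ?orbF // inE IH orbCA. Qed.

Lemma formula_sig_exs ys p : formula_sig (exs ys p) = formula_sig p.
Proof. by elim: ys. Qed.

Lemma formula_sig_ands T p (f : T -> formula) s R :
  (R \in formula_sig (ands p f s)) =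
  (R \in formula_sig p) || has (fun y => R \in formula_sig (f y)) s.
Proof. by elim: s => /= [|y s IH]; rewrite ?orbF // inE IH orbCA. Qed.

Lemma unfo_exs ys p : unfo (exs ys p) = unfo p.
Proof. by elim: ys. Qed.

Lemma unfo_ands T p (f : T -> formula) s :
  unfo (ands p f s) = unfo p && all (fun x => unfo (f x)) s.
Proof. by elim: s => /= [|y s ->]; rewrite ?andbT // andbCA. Qed.

Lemma atom_conj_ands T p (f : T -> formula) s :
  is_atom_conj (ands p f s) =
  is_atom_conj p && all (fun x => is_atom_conj (f x)) s.
Proof. by elim: s => /= [|y s ->]; rewrite ?andbT // andbCA. Qed.

Lemma cq_exs ys p : is_atom_conj p -> is_cq (exs ys p).
Proof. by move=> cp; elim: ys => //=; case: p cp. Qed.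

Lemma ucq_cq p : is_cq p -> is_ucq p.
Proof. by case: p. Qed.

Section Ontology.

Variable P : program.
Hypothesis P_mddlog : is_mddlog P.

Local Notation G := (goal P).

Definition is_goal_rule (r : rule) : bool := G \in atoms_syms (rule_head r).

(** Plays the part of falsum: the ontology forbids its fact. Its name also exceeds that of the goal,
    which may occur in no rule at all. *)
Definition empty_sym : symbol :=
  ((\max_(R <- idb P `|` edb P) R.1 + G.1)%N.+1, 0).
Definition empty_atom T : atom T := mk_atom (R := empty_sym) [tuple].

Definition body_vars (r : rule) : {fset var} := atoms_vars (rule_body r).

Definition answer_var_base : nat :=
  (\max_(x <- \bigcup_(r <- rules P) body_vars r) x).+1.

Definition answer_vars : (arity G).-tuple var :=
  [tuple (answer_var_base + i)%N | i < arity G].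

(* Starting from the first atom instead of "true" duplicates it; there is no
   formula "true" without free variables. *)
Definition body_formula (r : rule) : formula :=
  ands (Rel (head (empty_atom var) (rule_body r))) (@Rel) (rule_body r).

Definition rule_sentence (r : rule) : formula :=
  Not (exs (body_vars r)
    (ands (body_formula r) (fun a => Not (Rel a)) (rule_head r))).

Definition goal_args (r : rule) : seq var :=
  atom_args (head (empty_atom var) (rule_head r)).

(** The goal atom may repeat variables while answer variables are distinct and common to all
    disjuncts; hence fresh answer variables tied to the goal arguments by equalities. *)
Definition rule_cq (r : rule) : formula :=
  exs (body_vars r)
    (ands (body_formula r)
       (fun i => Equal ((answer_var_base + i)%N) (nth 0 (goal_args r) i))
       (iota 0 (arity G))).

Definition rule_ontology : seq formula :=
  Not (Rel (empty_atom var)) ::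
  [seq rule_sentence r | r <- rules P & ~~ is_goal_rule r].

(* The disjunct [empty_atom] is unsatisfiable and keeps the union nonempty when
   there is no goal rule. *)
Definition rule_ucq : formula :=
  foldr (fun r q => Or (rule_cq r) q) (Rel (empty_atom var))
    [seq r <- rules P | is_goal_rule r].

Local Notation T := (edb P `|` ontology_sig rule_ontology).

(** * Syntax of the translated rules *)

Lemma ruleP r : List.In r (rules P) ->
  [/\ rule_body r != [::],
      {subset atoms_vars (rule_head r) <= body_vars r},
      forall a, a \in rule_body r -> atom_sym a != G &
      if is_goal_rule r
      then exists2 h, rule_head r = [:: h] & atom_sym h = G
      else forall a, a \in rule_head r -> atom_sym a != G /\ arity (atom_sym a) = 1].
Proof.
case: P_mddlog => dd un rP.
have [[b0 /fsubsetP hv] gb gh] := iffLR (List.Forall_forall _ _) dd r rP.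
split=> //; first exact/eqP.
  move=> a ab; apply: contraNneq gb => <-; rewrite inE.
  exact: map_f.
have hsym a : a \in rule_head r -> atom_sym a \in idb P.
  move=> ah; rewrite /idb /head_syms in_bigfcup; apply/has_inP.
  by exists r; rewrite // inE map_f.
rewrite /is_goal_rule; case: ifP => gr.
  have := gh gr; move: gr; rewrite inE.
  case: (rule_head r) => [|h [|//]] //=.
  by rewrite inE => /eqP-> _; exists h.
move=> a ah; have aG : atom_sym a != G.
  by apply: contraFneq gr => <-; rewrite inE map_f.
by split=> //; apply: un; first exact: hsym.
Qed.

Lemma head_idb r a : List.In r (rules P) -> a \in rule_head r ->
  atom_sym a \in idb P.
Proof.
move=> rP ah; rewrite /idb /head_syms in_bigfcup; apply/has_inP.
by exists r; rewrite // inE map_f.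
Qed.

Lemma body_idb_edb r a : List.In r (rules P) -> a \in rule_body r ->
  atom_sym a \in idb P `|` edb P.
Proof.
move=> rP ab; rewrite in_fsetU /edb in_fsetD; case: (_ \in idb P) => //=.
rewrite in_fsetU; apply/orP; right.
by rewrite /body_syms in_bigfcup; apply/has_inP; exists r; rewrite // inE map_f.
Qed.

Lemma empty_sym_fresh : empty_sym \notin idb P `|` edb P.
Proof.
apply/negP => /(@leq_bigmax_seq _ _ xpredT (fun R : symbol => R.1)) /(_ isT).
by rewrite /= ltnNge leq_addr.
Qed.

Lemma goal_edb : G \notin edb P.
Proof.
rewrite /edb !inE; apply/negP => /andP[/negPf Gh].
rewrite /idb in Gh; rewrite Gh /= /body_syms in_bigfcup => /has_inP[r rP].
rewrite inE => /mapP[a ab Ga]; have [_ _ /(_ a ab)] := ruleP rP.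
by rewrite -Ga eqxx.
Qed.

Lemma rule_sentence_sig r R : rule_body r != [::] ->
  (R \in formula_sig (rule_sentence r)) =
  (R \in map (@atom_sym _) (rule_body r)) ||
  (R \in map (@atom_sym _) (rule_head r)).
Proof.
move=> b0; rewrite /= formula_sig_exs formula_sig_ands /body_formula.
have in_has (s : seq (atom var)) :
    has (fun a => R \in [fset atom_sym a]) s = (R \in map (@atom_sym _) s).
  by elim: s => //= a s ->; rewrite !inE.
rewrite formula_sig_ands /= !in_has; congr orb.
by case: (rule_body r) b0 => //= a s _; rewrite !inE; case: eqP.
Qed.

Lemma rule_cq_sig r R : rule_body r != [::] ->
  R \in formula_sig (rule_cq r) -> R \in map (@atom_sym _) (rule_body r).
Proof.
move=> b0; rewrite /= formula_sig_exs formula_sig_ands /body_formula.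
have in_has (s : seq (atom var)) :
    has (fun a => R \in [fset atom_sym a]) s = (R \in map (@atom_sym _) s).
  by elim: s => //= a s ->; rewrite !inE.
rewrite formula_sig_ands /= in_has => /orP[/orP[|//]|/hasP[i _]]; last by rewrite inE.
by case: (rule_body r) b0 => //= a s _; rewrite !inE => /eqP->; rewrite eqxx.
Qed.

Lemma ontology_sigP R :
  R \in ontology_sig rule_ontology <->
  R = empty_sym \/ exists r, [/\ List.In r (rules P), ~~ is_goal_rule r &
    (R \in map (@atom_sym _) (rule_body r)) ||
    (R \in map (@atom_sym _) (rule_head r))].
Proof.
rewrite /ontology_sig /rule_ontology in_bigfcup /= inE.
split=> [/orP[/eqP->|/has_inP[f /In_map[r /In_filter[rP rg] ->]]]|].
- by left.
- have [b0 _ _ _] := ruleP rP; rewrite rule_sentence_sig // => Rr.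
  by right; exists r.
- case=> [->|[r [rP rg Rr]]]; first by rewrite eqxx.
  apply/orP; right; apply/has_inP; exists (rule_sentence r).
    by apply/In_map; exists r => //; apply/In_filter.
  by have [b0 _ _ _] := ruleP rP; rewrite rule_sentence_sig.
Qed.

Lemma goal_full : G \notin T.
Proof.
rewrite inE (negPf goal_edb) /=; apply/negP => /ontology_sigP[|[r [rP rg]]].
  move=> /(congr1 fst) /= e.
  have := leq_addl (\max_(R <- idb P `|` edb P) R.1) G.1.
  by rewrite -ltnS -e ltnn.
have [_ _ gb] := ruleP rP; rewrite (negPf rg) => gh.
case/orP => /mapP[a ar Ga].
  by have := gb a ar; rewrite -Ga eqxx.
by have [+ _] := gh a ar; rewrite -Ga eqxx.
Qed.

(** A rule with a non-goal IDB symbol in its head is not a goal rule, so its sentence is in the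
    ontology. *)
Lemma idb_edb_full R : R \in idb P `|` edb P -> R != G -> R \in T.
Proof.
rewrite !in_fsetU => /orP[|->//] Ri RG; apply/orP; right.
move: Ri; rewrite /idb /head_syms in_bigfcup => /has_inP[r rP].
rewrite inE => Rr; apply/ontology_sigP; right; exists r; split=> //.
  apply/negP => gr; have [_ _ _] := ruleP rP; rewrite gr => -[h hE hG].
  by move: Rr RG; rewrite hE inE hG => /eqP->; rewrite eqxx.
by rewrite Rr orbT.
Qed.

(** * Semantics of the translated rules *)

Lemma sat_body dom D v r : rule_body r != [::] ->
  sat dom D v (body_formula r) <->
  all (fun a => atom_map v a \in D) (rule_body r).
Proof.
move=> b0; rewrite sat_ands; split=> [[_ H]|/allP H]; first exact/allP.
split=> //=; apply: H.
by case: (rule_body r) b0 => //= a s _; rewrite mem_head.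
Qed.

Lemma body_adom (D : instance) v r x :
  all (fun a => atom_map v a \in D) (rule_body r) -> x \in body_vars r ->
  v x \in adom D.
Proof.
move=> /allP bD; rewrite in_atoms_vars => /hasP[a ab xa].
by apply: mem_adom_arg (bD a ab) _; rewrite atom_map_args map_f.
Qed.

Lemma body_formula_vars r x : rule_body r != [::] ->
  (x \in free_vars (body_formula r)) = (x \in body_vars r).
Proof.
move=> b0; rewrite free_vars_ands in_atoms_vars /=.
have -> : has (fun a => x \in free_vars (Rel a)) (rule_body r) =
    has (fun a => x \in atom_args a) (rule_body r).
  by apply: eq_has => a; rewrite /= inE.
by case: (rule_body r) b0 => //= a s _; rewrite inE orbA orbb.
Qed.

(** Quantifiers range over [dom] but rule valuations over all constants; the two agree because body
    atoms force body variables into the active domain. *)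
Lemma sat_rule_sentence dom D v r :
  List.In r (rules P) -> adom D `<=` dom ->
  sat dom D v (rule_sentence r) <-> sat_rule D r.
Proof.
move=> rP /fsubsetP Dd; have [b0 hv _ _] := ruleP rP; rewrite /= sat_exs.
split=> [H w bw|H [w [wv wd]]].
  apply: contrapT => /negP/hasPn nh; apply: H.
  pose w' x := if x \in body_vars r then w x else v x.
  have ww' a : {subset atom_args a <= body_vars r} -> atom_map w' a = atom_map w a.
    by move=> ar; apply: eq_in_atom_map => x /ar; rewrite /w' => ->.
  exists w'; split=> [x /negPf xr|x xr|]; rewrite /w' ?xr //.
    by apply: Dd; apply: body_adom bw xr.
  apply/sat_ands; split=> [|a ah /=].
    apply/sat_body => //; apply/allP => a ab; rewrite ww' ?(allP bw) // => x xa.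
    by rewrite in_atoms_vars; apply/hasP; exists a.
  rewrite ww' => [|x xa]; first by apply/negP/nh.
  by apply: hv; rewrite in_atoms_vars; apply/hasP; exists a.
case/sat_ands => /(sat_body _ _ _ b0) /H /hasP[a ah aD] /(_ a ah).
by apply.
Qed.

Lemma rule_modelsP dom D : adom D `<=` dom ->
  models dom D rule_ontology <->
  empty_atom const \notin D /\
  forall r, List.In r (rules P) -> ~~ is_goal_rule r -> sat_rule D r.
Proof.
move=> Dd; have eE v : atom_map v (empty_atom var) = empty_atom const.
  by congr mk_atom; apply: val_inj.
rewrite /models List.Forall_forall; split=> [H|[He Hr] f].
  split=> [|r rP rg].
    by have := H _ (or_introl erefl) (fun=> 0); rewrite /= eE => /negP.
  apply/(sat_rule_sentence (fun=> 0) rP Dd); apply: H; right.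
  by apply/In_map; exists r => //; apply/In_filter.
move=> /= [<- v|/In_map[r /In_filter[rP rg] ->] v] /=.
  by rewrite eE; apply/negP.
exact/(sat_rule_sentence v rP Dd)/Hr.
Qed.

Lemma rule_ontology_unfo : ontology UNFO rule_ontology.
Proof.
apply/List.Forall_forall => f /= [<-|/In_map[r /In_filter[rP rg] ->]].
  have e : free_vars (Rel (empty_atom var)) = fset0.
    by apply/fsetP => x; rewrite !inE.
  split; first exact: e.
  by change (#|` free_vars (Rel (empty_atom var))| <= 1); rewrite e cardfs0.
have [b0 hv _] := ruleP rP; rewrite (negPf rg) => hu.
have fv0 : free_vars (rule_sentence r) = fset0.
  apply/fsetP => x; rewrite /= free_vars_exs free_vars_ands body_formula_vars //.
  rewrite inE; case xr : (x \in body_vars r) => //=.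
  apply/hasP => -[a ah /=]; rewrite inE => xa.
  suff : x \in body_vars r by rewrite xr.
  by apply: hv; rewrite in_atoms_vars; apply/hasP; exists a.
split=> //; rewrite /rule_sentence /= in fv0 *.
rewrite fv0 cardfs0 andbT unfo_exs unfo_ands /body_formula unfo_ands /=.
apply/andP; split; first exact/allP.
apply/allP => a ah; have [_ a1] := hu a ah.
by rewrite (leq_trans (card_fset_seq _)) // size_tuple a1.
Qed.

Lemma rule_ucq_ucq : is_ucq rule_ucq.
Proof.
rewrite /rule_ucq; elim: [seq r <- rules P | is_goal_rule r] => //= r s ->.
rewrite andbT; apply: ucq_cq; apply: cq_exs.
by rewrite atom_conj_ands /body_formula atom_conj_ands /=; apply/andP; split; exact/allP.
Qed.

Lemma answer_vars_uniq : uniq answer_vars.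
Proof.
rewrite map_inj_in_uniq ?enum_uniq // => i j _ _ /eqP.
by rewrite eqn_add2l => /eqP /val_inj.
Qed.

Lemma answer_var_notin r i : List.In r (rules P) ->
  (answer_var_base + i)%N \notin body_vars r.
Proof.
move=> rP; apply/negP => ir.
have : (answer_var_base + i)%N \in \bigcup_(r <- rules P) body_vars r.
  by rewrite in_bigfcup; apply/has_inP; exists r.
move=> /(@leq_bigmax_seq _ _ xpredT id) /(_ isT).
by rewrite /answer_var_base leqNgt ltnS leq_addr.
Qed.

Lemma goal_argsP r : List.In r (rules P) -> is_goal_rule r ->
  [/\ size (goal_args r) = arity G,
      {subset goal_args r <= body_vars r} &
      forall w (b : (arity G).-tuple const), map w (goal_args r) = b ->
        map (atom_map w) (rule_head r) = [:: mk_atom b]].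
Proof.
move=> rP gr; have [_ hv _] := ruleP rP; rewrite gr => -[h hE hG].
rewrite /goal_args hE /= in hv *; split.
- by rewrite -hG; case: (h) => R t; rewrite size_tuple.
- by move=> x xh; apply: hv; rewrite in_atoms_vars /= xh.
- case: h hG {hE hv} => R t /= RG; subst R => w b e.
  by congr [:: mk_atom _]; apply: val_inj.
Qed.

Lemma free_vars_ors (T' : Type) p (f : T' -> formula) s x :
  (x \in free_vars (foldr (fun y q => Or (f y) q) p s)) =
  (x \in free_vars p) || has (fun y => x \in free_vars (f y)) s.
Proof. by elim: s => /= [|y s IH]; rewrite ?orbF // inE IH orbCA. Qed.

Lemma formula_sig_ors (T' : Type) p (f : T' -> formula) s R :
  (R \in formula_sig (foldr (fun y q => Or (f y) q) p s)) =
  (R \in formula_sig p) || has (fun y => R \in formula_sig (f y)) s.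
Proof. by elim: s => /= [|y s IH]; rewrite ?orbF // inE IH orbCA. Qed.

Lemma sat_ors (T' : Type) dom D v p (f : T' -> formula) s :
  sat dom D v (foldr (fun y q => Or (f y) q) p s) <->
  sat dom D v p \/ exists2 y, List.In y s & sat dom D v (f y).
Proof.
elim: s => [|y s IH] /=; first by split=> [|[//|[y []]]]; left.
rewrite IH; split=> [[fy|[sp|[z zs fz]]]|[sp|[z [<-|zs] fz]]]; auto.
- by right; exists y; auto.
- by right; exists z; auto.
- by right; right; exists z.
Qed.

Lemma rule_ucq_vars : {subset free_vars rule_ucq <= answer_vars}.
Proof.
move=> x; rewrite free_vars_ors /= inE /= => /has_inP[r /In_filter[rP rg]].
have [b0 _ _ _] := ruleP rP; have [gs gv _] := goal_argsP rP rg.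
rewrite free_vars_exs free_vars_ands body_formula_vars // => /andP[/negPf xr].
rewrite xr /= => /hasP[i]; rewrite mem_iota add0n /= => iG.
rewrite !inE => /orP[/eqP->|/eqP xE].
  by apply/mapP; exists (Ordinal iG); rewrite ?mem_enum.
by move: xr; rewrite xE gv // mem_nth ?gs.
Qed.

Lemma rule_ucq_sig : formula_sig rule_ucq `<=` T.
Proof.
apply/fsubsetP => R; rewrite formula_sig_ors /= inE => /orP[/eqP->|].
  by rewrite in_fsetU; apply/orP; right; apply/ontology_sigP; left.
case/has_inP => r /In_filter[rP rg].
have [b0 _ bG _] := ruleP rP; move=> /(rule_cq_sig b0) /mapP[a ab ->].
by apply: idb_edb_full; [exact: body_idb_edb ab|exact: bG].
Qed.

Lemma sat_rule_cq D v r (b : (arity G).-tuple const) :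
  List.In r (rules P) -> is_goal_rule r -> map_tuple v answer_vars = b ->
  sat (adom D) D v (rule_cq r) <->
  exists2 w, all (fun a => atom_map w a \in D) (rule_body r) &
             map w (goal_args r) = b.
Proof.
move=> rP rg vb; have [b0 _ _ _] := ruleP rP.
have [gs gv _] := goal_argsP rP rg.
have vE i : i < arity G -> v (answer_var_base + i)%N = nth 0 b i.
  by move=> iG; rewrite -(tnth_nth 0 b (Ordinal iG)) -vb tnth_map tnth_mktuple.
rewrite /rule_cq sat_exs; split=> [[w [wv wd /sat_ands[/sat_body H He]]]|[w wb wg]].
  exists w; first exact: H.
  apply: (@eq_from_nth _ 0); rewrite size_map gs ?size_tuple // => i iG.
  rewrite (nth_map 0) ?gs // -vE // -wv ?answer_var_notin //.
  by apply/esym/He; rewrite mem_iota.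
pose w' x := if x \in body_vars r then w x else v x.
exists w'; split=> [x /negPf xr|x xr|]; rewrite /w' ?xr //.
  exact: body_adom wb xr.
apply/sat_ands; split=> [|i].
  apply/sat_body => //; apply/allP => a ab.
  rewrite (_ : atom_map _ a = atom_map w a) ?(allP wb) //.
  apply: eq_in_atom_map => x xa; rewrite ifT //.
  by rewrite in_atoms_vars; apply/hasP; exists a.
rewrite mem_iota add0n /= => iG.
rewrite (negPf (answer_var_notin i rP)) vE // gv ?mem_nth ?gs //.
by rewrite -wg (nth_map 0) ?gs.
Qed.

Lemma rule_ucq_answers D (b : (arity G).-tuple const) :
  fo_answers answer_vars rule_ucq D b <->
  {subset b <= adom D} /\
  (empty_atom const \in D \/ exists r w,
    [/\ List.In r (rules P), is_goal_rule r,
        all (fun a => atom_map w a \in D) (rule_body r) &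
        map w (goal_args r) = b]).
Proof.
have eE v : atom_map v (empty_atom var) = empty_atom const.
  by congr mk_atom; apply: val_inj.
split=> -[bD].
  move=> [v vb sv]; split=> //; move: sv => /sat_ors[/= e|[r /In_filter[rP rg]]].
    by left; rewrite eE in e.
  by move=> /(sat_rule_cq D rP rg vb)[w wb wg]; right; exists r, w.
move=> H; split=> //; pose v x := nth 0 b (x - answer_var_base).
have vb : map_tuple v answer_vars = b.
  apply: eq_from_tnth => i; rewrite tnth_map tnth_mktuple /v addKn.
  by rewrite -tnth_nth.
exists v => //; apply/sat_ors; case: H => [e|[r [w [rP rg wb wg]]]].
  by left; rewrite /= eE.
right; exists r; first exact/In_filter.
by apply/(sat_rule_cq D rP rg vb); exists w.
Qed.

Lemma rule_ucq_UCQ : UCQ (fo_query T answer_vars rule_ucq).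
Proof.
apply: UCQ_query; [exact: rule_ucq_ucq|exact: answer_vars_uniq|
  exact: rule_ucq_vars|exact: rule_ucq_sig].
Qed.

(** Models of the program and of the ontology differ in goal facts only: these are dropped in one
    direction, and in the other added for exactly the answers to the union of conjunctive
    queries. *)
Lemma omq_ddlog D (a : (arity G).-tuple const) : instance_over (edb P) D ->
  certain_answers (fo_query T answer_vars rule_ucq) D a <->
  ddlog_answers D a.
Proof.
move=> DS; split=> -[aD H]; split=> //.
  move=> D' /fsubsetP DD' D'S /List.Forall_forall D'P.
  pose B : instance := [fset f in D' | atom_sym f \in T].
  have BE f : (f \in B) = (f \in D') && (atom_sym f \in T) by rewrite inE.
  (* The constant 0 keeps the domain nonempty even when [B] has no constants. *)
  pose dom := 0 |` adom B.
  have Bdom : adom B `<=` dom by exact: fsubsetUr.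
  have strB : is_structure T dom B.
    split=> //; first by apply/fset0Pn; exists 0; exact: fset1U1.
    by move=> f; rewrite !inE => /andP[].
  have eB : empty_atom const \notin B.
    rewrite !inE; apply/negP => /andP[/D'S e _].
    by move: e; rewrite (negPf empty_sym_fresh).
  have modB : models dom B rule_ontology.
    apply/(rule_modelsP Bdom); split=> // r rP rg v /allP vB.
    have /hasP[h hr hD'] : has (fun a => atom_map v a \in D') (rule_head r).
      apply: (D'P r rP); apply/allP => f /vB; rewrite inE.
      by case/andP.
    apply/hasP; exists h => //; rewrite BE hD' /= in_fsetU.
    apply/orP; right; apply/ontology_sigP; right; exists r; split=> //.
    by rewrite (map_f _ hr) orbT.
  have DB : D `<=` B.
    apply/fsubsetP => f fD; rewrite BE DD' //= in_fsetU.
    by apply/orP; left; exact: DS.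
  have /rule_ucq_answers[_ [|[r [w [rP rg /allP wB wa]]]]] := H dom B strB modB DB.
    by rewrite (negPf eB).
  have [_ _ /(_ w a wa) hE] := goal_argsP rP rg.
  have : has (fun h => h \in D') (map (atom_map w) (rule_head r)).
    rewrite has_map; apply: (D'P r rP); apply/allP => f /wB; rewrite inE.
    by case/andP.
  by rewrite hE /= orbF.
move=> dom B [dom0 BT Bdom] /(rule_modelsP Bdom)[_ BP] /fsubsetP DB.
(* Goal facts are added for the answers over [B], so the goal rules hold; the other rules hold
   already in [B]. *)
pose D' := instance_of (idb P `|` edb P) (adom B) (fun f =>
  f \in B \/ exists2 b, fo_answers answer_vars rule_ucq B b & f = mk_atom b).
have D'B f : f \in D' -> atom_sym f != G -> f \in B.
  by case/instance_ofP => _ _ [//|[b _ ->]]; rewrite eqxx.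
have : mk_atom a \in D'.
  apply: H.
  - apply/fsubsetP => f fD; apply/instance_ofP; split.
    + by rewrite in_fsetU (DS f fD) orbT.
    + by move=> c; exact: mem_adom_arg (DB f fD).
    + by left; exact: DB.
  - by move=> f /instance_ofP[].
  - apply/List.Forall_forall => r rP v /allP vD'.
    have [b0 hv bG hG] := ruleP rP.
    have vB : all (fun a => atom_map v a \in B) (rule_body r).
      by apply/allP => f fr; apply: D'B; [exact: vD'|exact: (bG f fr)].
    have argB h : h \in rule_head r -> {subset atom_args (atom_map v h) <= adom B}.
      move=> hr c /mapP[x xh ->]; apply: body_adom vB _; apply: hv.
      by rewrite in_atoms_vars; apply/hasP; exists h.
    have hidb h : h \in rule_head r -> atom_sym h \in idb P `|` edb P.
      by move=> hr; rewrite in_fsetU (head_idb rP hr).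
    have [rg|rg] := boolP (is_goal_rule r); last first.
      have /hasP[h hr hB] := BP r rP rg v vB.
      apply/hasP; exists h => //; apply/instance_ofP.
      by split; [exact: (hidb h hr)|exact: argB|left].
    have [gs gv hE] := goal_argsP rP rg.
    have gsz : size (map v (goal_args r)) == arity G by rewrite size_map gs.
    pose b := Tuple gsz.
    have {}hE := hE v b erefl.
    rewrite -(has_map (atom_map v) (mem D')) hE /= orbF.
    have [h hr hb] : exists2 h, h \in rule_head r & mk_atom b = atom_map v h.
      by apply/mapP; rewrite hE mem_head.
    apply/instance_ofP; split; rewrite ?hb; [exact: (hidb h hr)|exact: argB|].
    right; exists b => //; apply/rule_ucq_answers; split.
      by move=> c /mapP[x xg ->]; apply: body_adom vB _; exact: gv.
    by right; exists r, v.
case/instance_ofP => _ _ [/BT|[b qb /mk_atom_inj ->//]].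
by rewrite (negPf goal_full).
Qed.

End Ontology.

(** The type of a query depends on its schema, so the equation between schemas is eliminated here
    once and for all, leaving a pointwise description of the answers. *)
Lemma mddlog_transport S P : edb P = S -> is_mddlog P ->
  exists2 q : query S (arity (goal P)), MDDlog q &
    forall D a, q D a <-> ddlog_answers D a.
Proof. by move=> <- mP; exists (ddlog_query P). Qed.

Lemma UCQ_inv S n (q : query S n) : UCQ q ->
  exists (xs : n.-tuple var) phi,
    [/\ is_ucq phi, {subset free_vars phi <= xs} & q = fo_query S xs phi].
Proof. by move=> u; case: S n q / u => S n xs phi uq _ fv _; exists xs, phi. Qed.

Theorem theorem6 : same_expressive_power (OMQ UNFO UCQ) MDDlog.
Proof.
split=> S n q1 q1L; case: S n q1 / q1L.
  move=> P mP; exists (omq_query (fo_query (edb P `|` ontology_sig (rule_ontology P))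
    (answer_vars P) (rule_ucq P))).
    by apply: OMQ_query; [exact: rule_ontology_unfo|exact: rule_ucq_UCQ].
  by move=> D DS _ a; apply: iff_sym; exact: omq_ddlog.
move=> S O n q uO /UCQ_inv[xs [phi [uq fvq ->]]].
have [q2 Mq2 q2E] := mddlog_transport (omq_edb S O xs phi) (omq_mddlog S O xs phi).
exists q2 => // D DS D0 a; apply: iff_trans (iff_sym (q2E D a)).
split=> [ans|]; first exact: omq_complete.
exact: omq_sound.
Qed.
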